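(* Let $f\in S([0,1))$. Let $Y^n=(Y_1^n,\dots,Y_n^n)$, $n\in\mathbb{N}$, be observations from the regression model described in the context (with noise satisfying Condition (A)), let $(\gamma_n)_{n\in\mathbb{N}}$ be a (possibly random) sequence of smoothing parameters such that $\gamma_n\to0$ and $\gamma_n n/\log n\to\infty$ $\mathbb{P}$-almost surely, and let $\hat f_n\in\iota^n(\arg\min H_{\gamma_n}(\cdot,Y^n))$. Then: (i) $\mathbb{P}$-almost surely, $\#J(\hat f_n)=\#J(f)$ for all large enough $n$; (ii) $\rho_H(J(\hat f_n),J(f))=O\left(\frac{\log n}{n}\right)$ $\mathbb{P}$-almost surely; (iii) $\rho_H(J(\hat f_n),J(f))=O_{\mathbb{P}}\left(\frac1n\right)$.
   Context: Regression model: for each $n$, with $x_i^n=i/n$ ($0\le i\le n$), one observes $Y_i^n=\overline f_i^n+\xi_i^n$, $i=1,\dots,n$, where $\overline f_i^n=(x_i^n-x_{i-1}^n)^{-1}\int_{x_{i-1}^n}^{x_i^n}f(u)\,du$. Condition (A) on the triangular array of noise variables $(\xi_i^n)_{n\in\mathbb{N},1\le i\le n}$ (zero-mean, defined on a common probability space with measure $\mathbb{P}$): (i) for every $n$ the random variables $(\xi_i^n)_{1\le i\le n}$ are independent; (ii) there is a universal constant $\beta\in\mathbb{R}$ such that $\mathbb{E}e^{\nu\xi_i^n}\le e^{\beta\nu^2}$ for all $\nu\in\mathbb{R}$, $1\le i\le n$, $n\in\mathbb{N}$. Potts functional: for $u,Y\in\mathbb{R}^n$, $H_\gamma(u,Y)=\frac1n\sum_{i=1}^n(u_i-Y_i)^2+\gamma\cdot\#\{i:1\le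 i\le n-1,\ u_i\ne u_{i+1}\}$. The set of minimizers over $u\in\mathbb{R}^n$ is denoted $\arg\min H_\gamma(\cdot,Y)$; it need not be a singleton, and $\hat f_n$ comes from any choice of minimizer. Embedding: $\iota^n((u_1,\dots,u_n))=\sum_{i=1}^nu_i\mathbf{1}_{[(i-1)/n,i/n)}$ for $(u_1,\dots,u_n)\in\mathbb{R}^n$. $S([0,1))$ is the space of right-continuous step functions $\sum_{i=1}^m\alpha_i\mathbf{1}_{[t_i,t_{i+1})}$, $\alpha_i\in\mathbb{R}$, $0=t_1<\dots<t_{m+1}=1$, $m\in\mathbb{N}$. For $g\in S([0,1))$, $J(g)=\{t\in(0,1):g(t-)\ne g(t+)\}$. Hausdorff metric on closed subsets contained in $(0,1)$: for nonempty closed $A,B\subset(0,1)$, $\rho_H(A,B)=\max\{\max_{a\in A}\min_{b\in B}|b-a|,\ \max_{b\in B}\min_{a\in A}|b-a|\}$; for nonempty $A$, $\rho_H(A,\varnothing)=\rho_H(\varnothing,A)=1$; and $\rho_H(\varnothing,\varnothing)=0$. ''$O(\cdot)$ $\mathbb{P}$-almost surely'' means that almost surely the ratio is bounded in $n$ (with a possibly random bound); $O_{\mathbb{P}}$ denotes boundedness in probability. *)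

(* Defs.v *)
From HB Require Import structures.
From mathcomp Require Export all_boot all_order all_algebra.
From mathcomp Require Export all_classical all_reals all_analysis.
Export Order.TTheory GRing.Theory Num.Theory.
Export numFieldNormedType.Exports.

Set Implicit Arguments.
Unset Strict Implicit.
Unset Printing Implicit Defensive.

Local Open Scope classical_set_scope.
Local Open Scope ring_scope.

(* Functions on [0, 1) are represented as functions on R; an element of S01
   vanishes outside [0, 1). *)
Definition S01 (R : realType) : set (R -> R) :=
  [set f | exists (m : nat) (alpha t : nat -> R),
    [/\ t 0%N = 0, t m = 1, forall i, (i < m)%N -> t i < t i.+1 &
        f = fun x => \sum_(i < m) alpha i * \1_(`[t i, t i.+1[%classic) x]].

Definition jumps (R : realType) (g : R -> R) : set R :=
  [set t | 0 < t < 1 /\ lim (g x @[x --> t^'-]) <> lim (g x @[x --> t^'+])].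

(* The suprema and infima are maxima and minima when A and B are nonempty
   closed subsets of R contained in (0, 1), in particular when they are
   finite. *)
Definition rhoH (R : realType) (A B : set R) : R :=
  if A == set0 then (if B == set0 then 0 else 1)
  else if B == set0 then 1
  else Num.max (sup [set inf [set `|b - a| | b in B] | a in A])
               (sup [set inf [set `|b - a| | a in A] | b in B]).

Definition design (R : realType) (n i : nat) : R := i%:R / n%:R.

(* As i : 'I_n starts at 0, this is the mean of f over [x_i, x_(i+1)]. *)
Definition fbar (R : realType) (f : R -> R) (n : nat) (i : 'I_n) : R :=
  (design R n i.+1 - design R n i)^-1 *
  \int[lebesgue_measure]_(u in `[design R n i, design R n i.+1]) f u.

Definition observation (R : realType) (T : Type) (f : R -> R)
    (xi : forall n, 'I_n -> T -> R) (n : nat) (w : T) : 'rV[R]_n :=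
  \row_(i < n) (fbar f i + xi n i w).

Definition mutually_independent d (T : measurableType d) (R : realType)
    (P : probability T R) (I : finType) (X : I -> {RV P >-> R}) : Prop :=
  forall (J : {set I}) (A : I -> set R),
    (forall i, i \in J -> measurable (A i)) ->
    P (\bigcap_(i in [set` J]) (X i @^-1` A i)) =
    (\prod_(i in J) P (X i @^-1` A i))%E.

Definition conditionA d (T : measurableType d) (R : realType)
    (P : probability T R) (xi : forall n, 'I_n -> {RV P >-> R}) : Prop :=
  [/\ forall n (i : 'I_n), ('E_P[xi n i] = 0)%E,
      forall n, mutually_independent (xi n) &
      exists beta : R, forall n (i : 'I_n) (nu : R),
        ('M_P (xi n i) nu <= (expR (beta * nu ^+ 2))%:E)%E].

Definition num_jumps (R : realType) (n : nat) (u : 'rV[R]_n) : nat :=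
  #|[pred i : 'I_n |
      [exists j : 'I_n, (j == i.+1 :> nat) && (u 0 i != u 0 j)]]|.

Definition potts (R : realType) (n : nat) (gamma : R) (Y u : 'rV[R]_n) : R :=
  n%:R^-1 * (\sum_(i < n) (u 0 i - Y 0 i) ^+ 2) + gamma * (num_jumps u)%:R.

Definition argmin (R : realType) (U : Type) (F : U -> R) : set U :=
  [set u | forall v, F u <= F v].

Definition embed (R : realType) (n : nat) (u : 'rV[R]_n) : R -> R :=
  fun x => \sum_(i < n)
    u 0 i * \1_(`[design R n i, design R n i.+1[%classic) x.

(* X n = O_P(a n). The outer measure mu_ext P agrees with P on measurable sets;
   it is used because X n, built from an arbitrary choice of minimizers, need
   not be measurable. *)
Definition bigO_prob d (T : measurableType d) (R : realType)
    (P : probability T R) (X : nat -> T -> R) (a : nat -> R) : Prop :=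
  forall eps : R, 0 < eps -> exists C : R, forall n, (0 < n)%N ->
    (mu_ext P [set w | (C * `|a n| < `|X n w|)%R] <= eps%:E)%E.

(* Main.v *)
From HB Require Import structures.
Require Import Defs.
From mathcomp Require Import measurable_realfun finmap ring lra zify.
Set Implicit Arguments.
Unset Strict Implicit.
Unset Printing Implicit Defensive.
Local Open Scope classical_set_scope.
Local Open Scope ring_scope.

(** Sample [f] at the design points. The sequence [g i = f (i / n)] is constant
    between consecutive breakpoints, its jumps are those of [f], and the data
    are [Y = g + z], where [z] is the noise plus an averaging error confined to
    the few cells that contain a jump of [f].

    A minimizer [u] is compared with [g] itself. With [G = n gamma], [J] for
    the number of jumps and [M] such that every interval [I] of indices satisfies
    [(\sum_I z)^2 <= M |I|], the inequality [cost u <= cost g] reads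
    [\sum (u - g)^2 + G J(u) <= 2 \sum (u - g) z + G J(g)]. The difference
    [u - g] is constant on at most [J(u) + J(g) + 1] blocks, and on each block
    the noise term is at most [2 M] plus half of the squared norm
    ([piecewise_noise]). Hence [minimizer_sqdist]: the squared distance from [u]
    to [g] is at most [4 M (J(u) + J(g) + 1) + 2 G (J(g) - J(u))].

    The noise sums are sub-Gaussian, so that a union bound over the intervals
    and the Borel-Cantelli lemma give [M = O(log n)] almost surely
    ([eventually_not_loud]), whereas [G] is much larger than [log n] and
    much smaller than [n]. Then [J(u) <= J(g)] at once, and the squared
    distance is small compared with [n]. If [u] has no jump within [k]
    indices of a jump of [g] of size at least [del], the squared distance is at
    least [k del^2 / 2] ([sqdist_missed_jump]); so each jump of [g] has a jump
    of [u] in its vicinity, and counting makes this a bijection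
    ([minimizer_matching]). This is (i). Now the penalties cancel, the squared
    distance is [O(M) = O(log n)], and the same inequality places the jumps
    of [u] within [O(log n)] indices of those of [g], which is (ii).

    For (iii) a single jump of [u] is moved to the jump of [g] that it matches.
    On the stretch of length [l] between the two, [u] is close to the level of
    [g] on the wrong side, so the move lowers the cost unless the noise sum over
    the stretch exceeds [del l / 4] ([jump_within]). One end of the stretch is
    a fixed index; the union bound over [l >= K] is therefore a geometric tail,
    small for [K] large, uniformly in [n] ([drift_prob]).

    The exponential bounds rest on the factorization of expectations of
    products ([independent_expectation]), which is derived from the product rule
    for events by exchanging indicators for functions one variable at a time. *)

(** * Piecewise constant sequences and minimizers of the penalized cost *)

Section PiecewiseConstant.
Context {R : realFieldType}.
Implicit Types (h u g z Y : nat -> R) (n : nat).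

Definition jump_set h n : {set 'I_n} := [set i : 'I_n | (0 < i)%N && (h i.-1 != h i)].

Definition njump h n : nat := #|jump_set h n|.

Lemma njumpS h n : njump h n.+1 = (njump h n + ((0 < n) && (h n.-1 != h n)))%N.
Proof.
rewrite /njump -!sum1_card big_mkcond [in RHS]big_mkcond big_ord_recr/=.
congr (_ + _)%N.
  by apply: eq_bigr => i _; rewrite !inE.
by rewrite inE /=; case: ifP.
Qed.

(** A jump of the difference is a jump of one of the two sequences. *)
Lemma njumpB u g n : (njump (u \- g) n <= njump u n + njump g n)%N.
Proof.
apply: leq_trans (leq_card_setU _ _); apply: subset_leq_card.
apply/fintype.subsetP => i; rewrite !inE /= => /andP[-> /=].
by apply: contraNT; rewrite negb_or !negbK => /andP[/eqP-> /eqP->].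
Qed.

Definition noise_bound z n (M : R) := forall a b : nat, (a < b <= n)%N ->
  (\sum_(a <= i < b) z i) ^+ 2 <= M * (b - a)%:R.

Lemma noise_bound_ge0 z n M : noise_bound z n M -> (0 < n)%N -> 0 <= M.
Proof.
move=> zM n0; have := zM 0%N 1%N n0; rewrite subn0 mulr1.
exact/le_trans/sqr_ge0.
Qed.

Lemma sum_nat_const_interval (a b : nat) (c : R) :
  \sum_(a <= i < b) c = (b - a)%:R * c.
Proof. by rewrite sumr_const_nat mulr_natl. Qed.

(** Completing the square: on a block of length [L] with noise sum [S], the
    value [2 c S - c^2 L / 2] is largest at [c = 2 S / L], where it is
    [2 S^2 / L <= 2 M]. *)
Lemma const_noise z n M h s r c : noise_bound z n M -> (s < r <= n)%N ->
  (forall i, (s <= i < r)%N -> h i = c) ->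
  \sum_(s <= i < r) (2 * h i * z i - h i ^+ 2 / 2) <= 2 * M.
Proof.
move=> zM srn hc.
rewrite (eq_big_nat _ _ (F2 := fun i => 2 * c * z i - c ^+ 2 / 2)); last first.
  by move=> i /hc ->.
rewrite sumrB -mulr_sumr sum_nat_const_interval.
have := zM _ _ srn; set S := bigop _ _ _; set L := (_ - _)%:R.
have L0 : 0 < L by rewrite ltr0n subn_gt0; case/andP: srn.
move=> SM; rewrite -(ler_pM2r L0).
have := sqr_ge0 (c * L - 2 * S); nra.
Qed.

(** The number of blocks is one more than the number of jumps, and each block
    costs [2 M]. The induction leaves out the block that is still open on the
    right, since its noise can only be bounded once it is complete. *)
Lemma piecewise_noise z n M h : noise_bound z n M -> (0 < n)%N ->
  \sum_(0 <= i < n) (2 * h i * z i - h i ^+ 2 / 2) <= 2 * M * ((njump h n)%:R + 1).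
Proof.
move=> zM n0.
have M0 := noise_bound_ge0 zM n0.
pose F i := 2 * h i * z i - h i ^+ 2 / 2.
suff key r : (0 < r <= n)%N -> exists2 s, (s < r)%N &
    (forall i, (s <= i < r)%N -> h i = h r.-1) /\
    \sum_(0 <= i < s) F i <= 2 * M * (njump h r)%:R.
  have [|s sn [hs Hs]] := key n; first by rewrite n0/=.
  rewrite (@big_cat_nat _ _ _ s)//=; last exact: ltnW.
  by rewrite mulrDr mulr1 lerD// (const_noise zM _ hs)// sn leqnn.
elim: r => // -[_ _|r IH /andP[_ rn]].
  exists 0%N => //; split; first by move=> [|].
  by rewrite big_geq// mulr_ge0// mulr_ge0.
have [|s sr [hs Hs]] := IH; first by rewrite (ltnW rn).
rewrite njumpS/=; case: eqP => [hE|hN].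
  exists s; first exact: ltnW.
  split; last by rewrite addn0.
  move=> i /andP[si]; rewrite ltnS leq_eqVlt => /orP[/eqP->//|ir].
  by rewrite -hE hs// si.
exists r.+1 => //; split.
  by move=> i /andP[a b]; congr h; apply/eqP; rewrite eqn_leq a -ltnS b.
rewrite (@big_cat_nat _ _ _ s)//=; last exact: ltnW.
by rewrite natrD mulrDr mulr1 lerD// (const_noise zM _ hs)// sr (ltnW rn).
Qed.

Definition cost n (G : R) Y u :=
  \sum_(0 <= i < n) (u i - Y i) ^+ 2 + G * (njump u n)%:R.

(** Competitors may take any value at indices from [n] on; [cost] does not see
    them. *)
Definition minimizer n G Y u := forall v, cost n G Y u <= cost n G Y v.

Definition sqdist n u g := \sum_(0 <= i < n) (u i - g i) ^+ 2.

(** The basic inequality: the minimizer is compared with [g], and the cross term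
    is absorbed block by block, which costs half of the squared distance. *)
Lemma minimizer_sqdist n G Y u g M : (0 < n)%N ->
  minimizer n G Y u -> noise_bound (Y \- g) n M ->
  sqdist n u g <= 4 * M * ((njump u n)%:R + (njump g n)%:R + 1)
                  + 2 * G * ((njump g n)%:R - (njump u n)%:R).
Proof.
move=> n0 /(_ g) ug zM.
have := piecewise_noise (u \- g) zM n0.
have : \sum_(0 <= i < n) (u i - Y i) ^+ 2 - \sum_(0 <= i < n) (g i - Y i) ^+ 2 =
   sqdist n u g / 2 - \sum_(0 <= i < n)
     (2 * (u \- g) i * (Y \- g) i - (u \- g) i ^+ 2 / 2).
  rewrite /sqdist mulr_suml -!sumrB; apply: eq_bigr => i _ /=; lra.
have := njumpB u g n; rewrite -(ler_nat R) natrD.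
have := noise_bound_ge0 zM n0.
move: ug; rewrite /cost.
set a := (njump u n)%:R; set b := (njump g n)%:R; set c := (njump (u \- g) n)%:R.
set A := \sum_(0 <= i < n) (u i - Y i) ^+ 2.
set B := \sum_(0 <= i < n) (g i - Y i) ^+ 2.
set C := \sum_(0 <= i < n)
  (2 * (u \- g) i * (Y \- g) i - (u \- g) i ^+ 2 / 2); set Q := sqdist n u g.
move=> h1 M0 cab h2 h3.
have h4 : M * c <= M * (a + b) by rewrite ler_wpM2l.
nra.
Qed.

(** An extra jump costs [G], but lets the noise term grow by [2 M] only. *)
Lemma minimizer_njump_le n G Y u g M (J : nat) : (0 < n)%N ->
  minimizer n G Y u -> noise_bound (Y \- g) n M -> (njump g n <= J)%N ->
  4 * M * (J%:R + 1) < G ->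
  (njump u n <= J)%N.
Proof.
move=> n0 umin zM gJ MG; rewrite leqNgt; apply/negP => Ju.
have M0 := noise_bound_ge0 zM n0.
have := minimizer_sqdist n0 umin zM.
have : 0 <= sqdist n u g by apply: sumr_ge0 => i _; exact: sqr_ge0.
have : J%:R + 1 <= (njump u n)%:R :> R by rewrite natr1 ler_nat.
move: gJ; rewrite -(ler_nat R).
have := ler0n R (njump g n).
set a := (njump u n)%:R; set b := (njump g n)%:R; set j := J%:R.
move=> b0 bj ja Q0 Q.
have G4 : 0 <= G - 4 * M * (j + 1) by rewrite subr_ge0 ltW.
have G4' : 0 < G - 4 * M * (j + 1) by rewrite subr_gt0.
have h1 : M * b <= M * j by rewrite ler_wpM2l.
have h2 : 0 <= M * (a - j - 1) by rewrite mulr_ge0//; lra.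
have h3 : 0 <= (G - 4 * M * (j + 1)) * (a - j - 1) by rewrite mulr_ge0//; lra.
have h4 : 0 <= M * j * (a - j - 1).
  by rewrite mulr_ge0//; [rewrite mulr_ge0//; lra|lra].
have h5 : 0 <= (G - 4 * M * (j + 1)) * (j - b) by rewrite mulr_ge0//; lra.
have h6 : 0 <= M * j * (j - b).
  by rewrite mulr_ge0//; [rewrite mulr_ge0//; lra|lra].
have h7 : 0 <= M * j by rewrite mulr_ge0//; lra.
nra.
Qed.

Lemma sqdist_ge_window n u g (x y : nat) : (x <= y <= n)%N ->
  \sum_(x <= i < y) (u i - g i) ^+ 2 <= sqdist n u g.
Proof.
move=> /andP[xy yn]; rewrite /sqdist [X in _ <= X](@big_cat_nat _ _ _ x)//=; last first.
  exact: leq_trans xy yn.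
rewrite [X in _ <= _ + X](@big_cat_nat _ _ _ y)//=.
rewrite addrCA lerDl addr_ge0//; apply: sumr_ge0 => i _; exact: sqr_ge0.
Qed.

Lemma const_of_no_jump n u (x y : nat) : (y <= n)%N ->
  (forall i : 'I_n, (x < i < y)%N -> i \notin jump_set u n) ->
  forall i, (x <= i < y)%N -> u i = u x.
Proof.
move=> yn nj i; elim: i => [|i IH]; first by rewrite leqn0 => /andP[/eqP->].
move=> /andP[]; rewrite leq_eqVlt => /orP[/eqP<-//|xi iy].
rewrite -IH; last by rewrite -ltnS xi (ltnW iy).
have /= := nj (Ordinal (leq_trans iy yn)); rewrite xi iy => /(_ isT).
by rewrite inE /= negbK => /eqP.
Qed.

(** One constant cannot be close to both [a] and [b]:
    [(c - a)^2 + (c - b)^2 >= (a - b)^2 / 2]. *)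
Lemma sqdist_missed_jump n u g (p k : nat) (a b : R) :
  (k <= p)%N -> (p + k <= n)%N ->
  (forall i, (p - k <= i < p)%N -> g i = a) ->
  (forall i, (p <= i < p + k)%N -> g i = b) ->
  (forall i : 'I_n, (p < i + k)%N -> (i < p + k)%N -> i \notin jump_set u n) ->
  k%:R * (a - b) ^+ 2 / 2 <= sqdist n u g.
Proof.
move=> kp pkn ga gb nj.
have uc := @const_of_no_jump n u (p - k) (p + k) pkn.
have {}uc : forall i, (p - k <= i < p + k)%N -> u i = u (p - k)%N.
  by apply: uc => i /andP[i1 i2]; apply: nj; lia.
apply: le_trans (@sqdist_ge_window n u g (p - k) (p + k) _); last first.
  by rewrite pkn andbT; lia.
rewrite (@big_cat_nat _ _ _ p)/=; [|lia|lia].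
rewrite (eq_big_nat _ _ (F2 := fun=> (u (p - k)%N - a) ^+ 2)); last first.
  by move=> i ip; rewrite ga// uc//; lia.
rewrite [X in _ <= _ + X](eq_big_nat _ _ (F2 := fun=> (u (p - k)%N - b) ^+ 2)); last first.
  by move=> i ip; rewrite gb// uc//; lia.
rewrite !sum_nat_const_interval subKn// addKn.
have := sqr_ge0 (u (p - k)%N - a + (u (p - k)%N - b)).
have := ler0n R k.
set c := u _; set K := k%:R => K0 sq.
have := mulr_ge0 K0 sq; nra.
Qed.


Definition overwrite u (x y : nat) (c : R) : nat -> R :=
  fun i => if (x <= i < y)%N then c else u i.

(** The form in which moving a jump from [x] to [y] is seen not to create one. *)
Lemma njump_le_exchange n u v (x y : 'I_n) : x \in jump_set u n ->
  jump_set v n \subset y |: (jump_set u n :\ x) -> (njump v n <= njump u n)%N.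
Proof.
move=> xu /subset_leq_card/leq_trans; apply.
rewrite cardsU1 /njump [leqRHS](cardsD1 x) xu leq_add2r.
by case: (_ \notin _).
Qed.

Lemma njump_extend_right n u (x y : 'I_n) : (x < y)%N -> y \in jump_set u n ->
  (njump (overwrite u x y (u y)) n <= njump u n)%N.
Proof.
move=> xy yu; apply: (@njump_le_exchange _ _ _ y x yu).
apply/fintype.subsetP => i; rewrite !inE /overwrite -!val_eqE /=.
case: (ltngtP i x) => //= [ix|xi].
  by rewrite !ifF; lia.
case: (ltngtP i y) => //= [iy|yi|/val_inj ->].
- by rewrite ifT ?eqxx ?andbF//; lia.
- by rewrite ifF//; lia.
- by rewrite ifT ?eqxx ?andbF//; lia.
Qed.

Lemma njump_extend_left n u (x y : 'I_n) : (x < y)%N -> x \in jump_set u n ->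
  (njump (overwrite u x y (u x.-1)) n <= njump u n)%N.
Proof.
move=> xy xu; apply: (@njump_le_exchange _ _ _ x y xu).
apply/fintype.subsetP => i; rewrite !inE /overwrite -!val_eqE /=.
have x0 : (0 < x)%N by move: xu; rewrite inE => /andP[].
case: (ltngtP i y) => //= [iy|yi].
- case: (ltngtP i x) => //= [ix|xi|/val_inj->].
  + by rewrite ifF//; lia.
  + by rewrite ifT ?eqxx ?andbF//; lia.
  + by rewrite ifF ?eqxx ?andbF//; lia.
- by rewrite !ifF//; lia.
Qed.

Lemma minimizer_replace n G Y u (x y : nat) c : minimizer n G Y u -> 0 <= G ->
  (x <= y <= n)%N -> (njump (overwrite u x y c) n <= njump u n)%N ->
  \sum_(x <= i < y) (u i - Y i) ^+ 2 <= \sum_(x <= i < y) (c - Y i) ^+ 2.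
Proof.
move=> /(_ (overwrite u x y c)) umin G0 /andP[xy yn]; rewrite -(ler_nat R) => vu.
have {umin} : \sum_(0 <= i < n) (u i - Y i) ^+ 2 <=
              \sum_(0 <= i < n) (overwrite u x y c i - Y i) ^+ 2.
  rewrite -(lerD2r (G * (njump u n)%:R)); apply: le_trans umin _.
  by rewrite lerD2l ler_wpM2l.
rewrite [leLHS](@big_cat_nat _ _ _ x)//=; last exact: leq_trans xy yn.
rewrite [leRHS](@big_cat_nat _ _ _ x)//=; last exact: leq_trans xy yn.
rewrite (eq_big_nat _ _ (F1 := fun i => (overwrite u x y c i - _) ^+ 2)
   (F2 := fun i => (u i - Y i) ^+ 2)); last first.
  by move=> i ix; rewrite /overwrite ifF//; lia.
rewrite lerD2l [leLHS](@big_cat_nat _ _ _ y)//=.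
rewrite [leRHS](@big_cat_nat _ _ _ y)//=.
rewrite [X in _ <= _ + X](eq_big_nat _ _ (F2 := fun i => (u i - Y i) ^+ 2));
  last first.
  by move=> i ix; rewrite /overwrite ifF//; lia.
rewrite lerD2r => /le_trans; apply.
rewrite le_eqVlt; apply/orP; left; apply/eqP; apply: eq_big_nat => i ix.
by rewrite /overwrite ix.
Qed.

(** The two sums of squares differ by
    [(c - c') (l (c + c' - 2 b) - 2 S)], where [l] is the length and [S] the
    noise sum. Both factors have the sign of [a - b]: by the hypotheses on the
    levels, [|c + c' - 2 b| >= 3 d / 4], and the noise accounts for at most
    [d / 2] of it per index. *)
Lemma wrong_level_costs (x y : nat) (a b c c' d : R) Y : (x < y)%N -> 0 < d ->
  d <= `|a - b| -> `|c - a| <= d / 8 -> `|c' - b| <= d / 8 ->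
  `|\sum_(x <= i < y) (Y i - b)| <= d / 4 * (y - x)%:R ->
  \sum_(x <= i < y) (c' - Y i) ^+ 2 < \sum_(x <= i < y) (c - Y i) ^+ 2.
Proof.
move=> xy d0; rewrite !ler_norml => dab /andP[ca1 ca2] /andP[cb1 cb2].
have : \sum_(x <= i < y) (c - Y i) ^+ 2 - \sum_(x <= i < y) (c' - Y i) ^+ 2 =
  (c - c') * ((y - x)%:R * (c + c' - 2 * b) - 2 * \sum_(x <= i < y) (Y i - b)).
  rewrite -sumrB mulr_sumr -sum_nat_const_interval -sumrB mulr_sumr.
  by apply: eq_bigr => i _; ring.
have L0 : 0 < (y - x)%:R :> R by rewrite ltr0n subn_gt0.
set S := \sum_(x <= i < y) (Y i - b); set L := (y - x)%:R.
move=> E /andP[S1 S2]; rewrite -subr_gt0 E.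
have dL : 0 < d * L by rewrite mulr_gt0.
have [ab|ab] : a - b <= - d \/ d <= a - b by move: dab; case: ler0P; lra.
  rewrite -mulrNN mulr_gt0//; first by lra.
  have : L * (c + c' - 2 * b) <= L * (- (3 / 4 * d)) by rewrite ler_pM2l//; lra.
  lra.
rewrite mulr_gt0//; first by lra.
have : L * (3 / 4 * d) <= L * (c + c' - 2 * b) by rewrite ler_pM2l//; lra.
lra.
Qed.

Lemma sqdist_level n u g (x k : nat) (a c e : R) : (0 < k)%N -> (x + k <= n)%N ->
  0 <= e -> sqdist n u g <= k%:R * e ^+ 2 ->
  (forall i, (x <= i < x + k)%N -> u i = c) ->
  (forall i, (x <= i < x + k)%N -> g i = a) -> `|c - a| <= e.
Proof.
move=> k0 xkn e0 ue uc ga.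
have := @sqdist_ge_window n u g x (x + k); rewrite leq_addr xkn => /(_ isT).
rewrite (eq_big_nat _ _ (F2 := fun=> (c - a) ^+ 2)); last first.
  by move=> i ix; rewrite uc ?ga.
rewrite sum_nat_const_interval addKn => /le_trans/(_ ue).
rewrite ler_pM2l ?ltr0n// => ce.
by rewrite -(ler_pXn2r (n:=2))// ?nnegrE// -normrX ger0_norm// sqr_ge0.
Qed.

Local Ltac nat_lia := repeat match goal with H : forall _, _ |- _ => clear H end; lia.

(** The local exchange argument. Closeness in the squared distance forces [u] to
    be within [d / 8] of [a] on the left of [q] and of [b] on its right, because
    [u] is constant there on at least [k] indices where [g] is constant too. If
    [q] is at distance at least [K] from [p], moving the jump from [q] to [p]
    then lowers the cost strictly. The noise is controlled only on intervals with
    end point [p], which is all that the move involves. *)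
Lemma jump_within n G Y u g (p k K : nat) (q : 'I_n) (a b d : R) :
  minimizer n G Y u -> 0 <= G -> (0 < k)%N -> (0 < K)%N ->
  (3 * k <= p)%N -> (p + 3 * k <= n)%N ->
  q \in jump_set u n -> (p < q + k)%N -> (q < p + k)%N ->
  (forall i, (p - 3 * k <= i < q)%N -> u i = u (p - 3 * k)%N) ->
  (forall i, (q <= i < p + 3 * k)%N -> u i = u q) ->
  (forall i, (p - 3 * k <= i < p)%N -> g i = a) ->
  (forall i, (p <= i < p + 3 * k)%N -> g i = b) ->
  0 < d -> d <= `|a - b| ->
  sqdist n u g <= k%:R * (d / 8) ^+ 2 ->
  (forall l, (K <= l)%N -> (l <= p)%N ->
    `|\sum_(p - l <= i < p) (Y i - g i)| <= d / 4 * l%:R) ->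
  (forall l, (K <= l)%N -> (p + l <= n)%N ->
    `|\sum_(p <= i < p + l) (Y i - g i)| <= d / 4 * l%:R) ->
  (p < q + K)%N && (q < p + K)%N.
Proof.
move=> umin G0 k0 K0 kp pkn qu pq qp ul ur ga gb d0 dab ug nl nr.
have d8 : 0 <= d / 8 by lra.
have la : `|u (p - 3 * k)%N - a| <= d / 8.
  apply: (@sqdist_level n u g (p - 3 * k) k a _ _ k0 _ d8 ug).
  - nat_lia.
  - by move=> i ip; apply: ul; nat_lia.
  - by move=> i ip; apply: ga; nat_lia.
have rb : `|u q - b| <= d / 8.
  apply: (@sqdist_level n u g (p + k) k b _ _ k0 _ d8 ug).
  - nat_lia.
  - by move=> i ip; apply: ur; nat_lia.
  - by move=> i ip; apply: gb; nat_lia.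
have pn : (p < n)%N by nat_lia.
pose P := Ordinal pn.
apply/andP; split; rewrite ltnNge; apply/negP => far.
- have qP : (q < P)%N by rewrite /=; nat_lia.
  have := njump_extend_left qP qu.
  move=> /(minimizer_replace umin G0); rewrite (ltnW qP) (ltnW pn) => /(_ isT).
  rewrite (eq_big_nat _ _ (F2 := fun i => (u q - Y i) ^+ 2)); last first.
    by move=> i ix; rewrite ur//; move: ix => /=; nat_lia.
  have -> : u q.-1 = u (p - 3 * k)%N.
    by apply: ul; move: qu; rewrite inE; nat_lia.
  apply/negP; rewrite -ltNge.
  apply: (@wrong_level_costs q p b a _ _ d) => //.
    by rewrite distrC.
  have -> : \sum_(q <= i < p) (Y i - a) = \sum_(p - (p - q) <= i < p) (Y i - g i).
    rewrite subKn; last by move: qP => /=; nat_lia.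
    by apply: eq_big_nat => i ix; rewrite ga//; nat_lia.
  by apply: nl; [nat_lia|rewrite leq_subr].
- have Pq : (P < q)%N by rewrite /=; nat_lia.
  have := njump_extend_right Pq qu.
  move=> /(minimizer_replace umin G0); rewrite (ltnW Pq) (ltnW (ltn_ord q)) => /(_ isT).
  rewrite (eq_big_nat _ _ (F2 := fun i => (u (p - 3 * k)%N - Y i) ^+ 2)); last first.
    by move=> i ix; rewrite ul//; move: ix => /=; nat_lia.
  apply/negP; rewrite -ltNge.
  apply: (@wrong_level_costs p q a b _ _ d) => //.
  have -> : \sum_(p <= i < q) (Y i - b) = \sum_(p <= i < p + (q - p)) (Y i - g i).
    rewrite subnKC; last by move: Pq => /=; nat_lia.
    by apply: eq_big_nat => i ix; rewrite gb//; nat_lia.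
  by apply: nr; [nat_lia|rewrite subnKC; [exact: ltnW|move: Pq => /=; nat_lia]].
Qed.

End PiecewiseConstant.

(** The choice of a partner is an injection, hence onto as soon as [B] is no
    larger than [A]. This turns the existence of nearby jumps, together with a
    bound on their number, into a one-to-one correspondence. *)
Lemma matching (I J : finType) (A : {set I}) (B : {set J}) (r : I -> J -> bool) :
  (forall i, i \in A -> exists2 j, j \in B & r i j) ->
  (forall i i' j, i \in A -> i' \in A -> j \in B -> r i j -> r i' j -> i = i') ->
  (#|A| <= #|B|)%N /\ ((#|B| <= #|A|)%N ->
    (forall j, j \in B -> exists2 i, i \in A & r i j) /\
    (forall i j j', i \in A -> j \in B -> j' \in B -> r i j -> r i j' -> j = j')).
Proof.
move=> AB rinj.
pose f i := [pick j in B | r i j].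
have fP i : i \in A -> exists j, [/\ f i = Some j, j \in B & r i j].
  move=> iA; rewrite /f; case: pickP => [j /andP[jB rij]|no]; first by exists j.
  by have [j jB rij] := AB _ iA; have := no j; rewrite jB rij.
have finj : {in A &, injective f}.
  move=> i i' iA i'A; have [j [-> jB rij]] := fP _ iA.
  by have [j' [-> j'B rij']] := fP _ i'A => -[E]; apply: (rinj i i' j); rewrite // E.
have fsub : f @: A \subset Some @: B.
  apply/fintype.subsetP => _ /imsetP[i iA ->]; have [j [-> jB _]] := fP _ iA.
  exact: imset_f.
have cB : #|Some @: B| = #|B| by rewrite card_imset//; apply: Some_inj.
have cA : #|f @: A| = #|A| by rewrite card_in_imset.
split; first by rewrite -cA -cB; exact: subset_leq_card.
move=> BA.
have E : f @: A = Some @: B by apply/eqP; rewrite eqEcard fsub cB cA.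
have sur j : j \in B -> exists i, [/\ i \in A, f i = Some j & r i j].
  move=> jB; have : Some j \in f @: A by rewrite E; exact: imset_f.
  move=> /imsetP[i iA fi]; exists i; split => //.
  by have [j' [fj' _ rij']] := fP _ iA; move: fi; rewrite fj' => -[->].
split=> [j /sur[i [iA _ rij]]|i j j' iA jB j'B rij rij']; first by exists i.
have [i1 [i1A fi1 ri1]] := sur _ jB; have [i2 [i2A fi2 ri2]] := sur _ j'B.
move: fi1 fi2; rewrite (rinj _ _ _ i1A iA jB ri1 rij) (rinj _ _ _ i2A iA j'B ri2 rij').
by move=> -> [].
Qed.

(** * Localization of the jumps of a minimizer *)

(** The distance is strictly less than [w]; stated without subtraction, which
    truncates. *)
Definition close_to (w a b : nat) := (a < b + w)%N && (b < a + w)%N.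

(** The setting of this section: [g] has the level [alpha j] on the indices from
    [p j] to [p j.+1], and each segment has at least [4 k] indices. Neighbouring
    levels may coincide, so the true jumps are the [p j] with [j] in
    [jump_set alpha m]. The factor 4 leaves, on each side of a jump, three
    windows of [k] indices that no jump matched to another breakpoint enters. *)
Section Segmentation.
Context {R : realFieldType} (n m k : nat) (p : nat -> nat) (alpha g : nat -> R).
Hypotheses (k_gt0 : (0 < k)%N) (p0 : p 0%N = 0%N) (pm : p m = n).
Hypothesis gap : forall j, (j < m)%N -> (p j + 4 * k <= p j.+1)%N.
Hypothesis gE : forall j i, (j < m)%N -> (p j <= i < p j.+1)%N -> g i = alpha j.

Lemma breakpoint_le i j : (i <= j <= m)%N -> (p i <= p j)%N.
Proof.
elim: j => [|j IH]; first by rewrite leqn0 => /andP[/eqP->].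
move=> /andP[]; rewrite leq_eqVlt => /orP[/eqP-> //|ij jm].
have := gap jm; have : (p i <= p j)%N by apply: IH; lia.
lia.
Qed.

Lemma breakpoint_lt i j : (i < j <= m)%N -> (p i + 4 * k <= p j)%N.
Proof.
move=> /andP[ij jm]; have := @breakpoint_le i.+1 j.
rewrite ij jm => /(_ isT); apply: leq_trans; apply: gap; exact: leq_trans jm.
Qed.

(** Distinct breakpoints are at least [4 k] apart, which leaves room for windows
    of half-width [2 k]. *)
Lemma breakpoint_near w (j j' : 'I_m) i : (w <= 2 * k)%N ->
  close_to w (p j) i -> close_to w (p j') i -> j = j'.
Proof.
rewrite /close_to => wk h1 h2; apply: val_inj => /=; case: (ltngtP j j') => // jj.
- by have := @breakpoint_lt j j'; rewrite jj (ltnW (ltn_ord j')) => /(_ isT); lia.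
- by have := @breakpoint_lt j' j; rewrite jj (ltnW (ltn_ord j)) => /(_ isT); lia.
Qed.

Lemma segment_of i : (i < n)%N -> exists2 j, (j < m)%N & (p j <= i < p j.+1)%N.
Proof.
rewrite -pm; suff key l : (l <= m)%N -> (i < p l)%N ->
    exists2 j, (j < l)%N & (p j <= i < p j.+1)%N by exact: key.
elim: l => [|j IH] jm; first by rewrite p0.
move=> ij; have [ij'|ij'] := ltnP i (p j).
  by have [|j' j'j h] := IH _ ij'; [exact: ltnW|exists j' => //; exact: ltnW].
by exists j; rewrite ?ltnSn// ij'.
Qed.

Lemma segmented_njump : (njump g n <= njump alpha m)%N.
Proof.
have [] := @matching _ _ (jump_set g n) (jump_set alpha m) (fun i j => p j == i :> nat).
- move=> i; rewrite inE => /andP[i0 gi].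
  have [j jm /andP[pj1 pj2]] := segment_of (ltn_ord i).
  have pji : p j = i.
    apply/anti_leq; rewrite /= pj1/= leqNgt; apply/negP => ij.
    by move: gi; rewrite (gE jm)// ?(gE jm) ?eqxx//; lia.
  exists (Ordinal jm); last exact/eqP.
  rewrite inE /=; case: j jm pj1 pj2 pji => [|j] jm pj1 pj2 pji.
    by move: i0; rewrite -pji p0.
  move: gi; rewrite /= (gE (ltnW jm)) ?(gE jm) ?pj1//.
  by have := gap (ltnW jm); lia.
- by move=> i i' j _ _ _ /eqP E /eqP E'; apply: val_inj; rewrite /= -E -E'.
- by [].
Qed.

Lemma jump_segments (j : 'I_m) : j \in jump_set alpha m ->
  [/\ (4 * k <= p j)%N, (p j + 4 * k <= n)%N,
   forall i, (p j - 4 * k <= i < p j)%N -> g i = alpha j.-1 &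
   forall i, (p j <= i < p j + 4 * k)%N -> g i = alpha j].
Proof.
rewrite inE => /andP[j0 _]; have jm := ltn_ord j.
have j1 : (j.-1 < m)%N by lia.
have g1 := gap j1; rewrite prednK// in g1; have g2 := gap jm.
have pjm : (p j.+1 <= n)%N by rewrite -pm; apply: breakpoint_le; rewrite jm leqnn.
split; [lia|lia| |].
- by move=> i ip; apply: (gE j1); rewrite prednK//; lia.
- by move=> i ip; apply: (gE jm); lia.
Qed.

Lemma jump_detected (u : nat -> R) w (j : 'I_m) (d : R) : (w <= k)%N ->
  j \in jump_set alpha m -> 0 <= d -> d <= `|alpha j.-1 - alpha j| ->
  sqdist n u g < w%:R * d ^+ 2 / 2 ->
  exists2 i : 'I_n, i \in jump_set u n & close_to w (p j) i.
Proof.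
move=> wk jD d0 dj ug; apply/exists_inP; apply: contraPT ug => /exists_inPn none.
have [h1 h2 h3 h4] := jump_segments jD.
apply/negP; rewrite -leNgt.
apply: (@le_trans _ _ (w%:R * (alpha j.-1 - alpha j) ^+ 2 / 2)).
  rewrite ler_pM2r; last by lra.
  by rewrite ler_wpM2l// -[leRHS]real_normK ?num_real// ler_pXn2r// ?nnegrE.
apply: (@sqdist_missed_jump _ _ _ _ (p j)).
- lia.
- lia.
- by move=> i ip; apply: h3; lia.
- by move=> i ip; apply: h4; lia.
- move=> i i1 i2; apply/negP => /none; rewrite /close_to; lia.
Qed.

Section Minimizer.
Context (G M d : R) (Y u : nat -> R).
Let J := njump alpha m.
Hypotheses (n_gt0 : (0 < n)%N) (d_gt0 : 0 < d).
Hypothesis jump_size :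
  forall j : 'I_m, j \in jump_set alpha m -> d <= `|alpha j.-1 - alpha j|.
Hypotheses (umin : minimizer n G Y u) (noise : noise_bound (Y \- g) n M).
Hypotheses (G_large : 4 * M * (J%:R + 1) < G).
Hypotheses (G_small : 2 * G * (J%:R + 1) < k%:R * d ^+ 2 / 2).

Let penalty_ge0 : 0 <= G.
Proof.
apply: ltW; apply: le_lt_trans G_large.
by rewrite !mulr_ge0 ?addr_ge0// (noise_bound_ge0 noise).
Qed.

(** The upper bound on [G] makes the squared distance too small for a jump to be
    missed by [k] indices; the lower bound prevents additional jumps. *)
Lemma minimizer_matching :
  njump u n = J /\
  (forall i : 'I_n, i \in jump_set u n ->
    exists2 j : 'I_m, j \in jump_set alpha m & close_to k (p j) i) /\
  (forall (j : 'I_m) (i i' : 'I_n), j \in jump_set alpha m -> i \in jump_set u n ->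
    i' \in jump_set u n -> close_to k (p j) i -> close_to k (p j) i' -> i = i').
Proof.
have M0 := noise_bound_ge0 noise n_gt0.
have gJ := segmented_njump.
have uJ := minimizer_njump_le n_gt0 umin noise gJ G_large.
have ug : sqdist n u g < k%:R * d ^+ 2 / 2.
  apply: le_lt_trans G_small; apply: (le_trans (minimizer_sqdist n_gt0 umin noise)).
  move: gJ uJ G_large; rewrite -/J -!(ler_nat R).
  have := ler0n R (njump u n); have := ler0n R (njump g n).
  move: (njump u n)%:R (njump g n)%:R (J%:R) => a b c b0 a0 bc ac Gc.
  have h1 : 0 <= M * (c - a) by rewrite mulr_ge0// subr_ge0.
  have h2 : 0 <= M * (c - b) by rewrite mulr_ge0// subr_ge0.
  have h3 : 0 <= M * c by rewrite mulr_ge0//; lra.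
  have G0 := penalty_ge0.
  have h4 : 0 <= G * (c - b) by rewrite mulr_ge0// subr_ge0.
  have h5 : 0 <= G * a by rewrite mulr_ge0.
  nra.
have [] := @matching _ _ (jump_set alpha m) (jump_set u n) (fun j i => close_to k (p j) i).
- by move=> j jD; apply: (jump_detected _ jD _ (jump_size jD)) => //; exact: ltW.
- by move=> j j' i _ _ _ h1 h2; apply: (@breakpoint_near k _ _ i) => //; clear -k_gt0; lia.
- move=> Ju /(_ uJ) [h1 h2]; split; last by [].
  by apply/eqP; rewrite eqn_leq uJ Ju.
Qed.

(** With equal numbers of jumps the penalties cancel, and only the noise level
    remains. This is what improves the localization from [O(G)] to [O(M)]. *)
Lemma minimizer_sqdist_le : sqdist n u g <= 4 * M * (2 * J%:R + 1).
Proof.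
have M0 := noise_bound_ge0 noise n_gt0.
have G0 := penalty_ge0.
apply: (le_trans (minimizer_sqdist n_gt0 umin noise)).
have [-> _] := minimizer_matching.
move: segmented_njump; rewrite -(ler_nat R) -/J; move: (njump g n)%:R (J%:R) => b c bc.
have h1 : 0 <= M * (c - b) by rewrite mulr_ge0// subr_ge0.
have h2 : 0 <= G * (c - b) by rewrite mulr_ge0 ?subr_ge0.
nra.
Qed.

Lemma jumps_close w : (w <= k)%N ->
  4 * M * (2 * J%:R + 1) < w%:R * d ^+ 2 / 2 ->
  (forall j : 'I_m, j \in jump_set alpha m ->
    exists2 i : 'I_n, i \in jump_set u n & close_to w (p j) i) /\
  (forall i : 'I_n, i \in jump_set u n ->
    exists2 j : 'I_m, j \in jump_set alpha m & close_to w (p j) i).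
Proof.
move=> wk wM; have [uJ [_ _]] := minimizer_matching.
have [||_] := @matching _ _ (jump_set alpha m) (jump_set u n) (fun j i => close_to w (p j) i).
- move=> j jD; apply: (jump_detected wk jD (ltW d_gt0) (jump_size jD)).
  exact: le_lt_trans minimizer_sqdist_le wM.
- by move=> j j' i _ _ _ h1 h2; apply: (@breakpoint_near w _ _ i) => //; clear -k_gt0 wk; lia.
rewrite /njump in uJ; rewrite uJ leqnn => /(_ isT) [h1 _].
split=> // j jD; apply: (jump_detected wk jD (ltW d_gt0) (jump_size jD)).
exact: le_lt_trans minimizer_sqdist_le wM.
Qed.

Lemma jumps_close_local K : (0 < K)%N ->
  4 * M * (2 * J%:R + 1) <= k%:R * (d / 8) ^+ 2 ->
  (forall j : 'I_m, j \in jump_set alpha m ->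
    (forall l, (K <= l)%N -> (l <= p j)%N ->
      `|\sum_(p j - l <= i < p j) (Y i - g i)| <= d / 4 * l%:R) /\
    (forall l, (K <= l)%N -> (p j + l <= n)%N ->
      `|\sum_(p j <= i < p j + l) (Y i - g i)| <= d / 4 * l%:R)) ->
  (forall j : 'I_m, j \in jump_set alpha m ->
    exists2 i : 'I_n, i \in jump_set u n & close_to K (p j) i) /\
  (forall i : 'I_n, i \in jump_set u n ->
    exists2 j : 'I_m, j \in jump_set alpha m & close_to K (p j) i).
Proof.
move=> K0 kM local; have [uJ [un uq]] := minimizer_matching.
have G0 := penalty_ge0.
have ug := le_trans minimizer_sqdist_le kM.
have improve (j : 'I_m) (q : 'I_n) : j \in jump_set alpha m -> q \in jump_set u n ->
    close_to k (p j) q -> close_to K (p j) q.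
  move=> jD qu jq; have [h1 h2 h3 h4] := jump_segments jD.
  have others (i : 'I_n) : i \in jump_set u n -> i != q ->
      ~~ ((p j - 3 * k <= i)%N && (i < p j + 3 * k)%N).
    move=> iu; apply: contraNN => iwin; have [j' j'D j'i] := un _ iu.
    suff E : j' = j by apply/eqP; apply: (uq j) => //; rewrite -E.
    apply: val_inj => /=; rewrite /close_to in j'i; case: (ltngtP j' j) => // jj.
    - by have := @breakpoint_lt j' j; rewrite jj (ltnW (ltn_ord j)) => /(_ isT);
        clear -j'i iwin; lia.
    - by have := @breakpoint_lt j j'; rewrite jj (ltnW (ltn_ord j')) => /(_ isT);
        clear -j'i iwin; lia.
  rewrite /close_to in jq *; have [l1 l2] := local _ jD.
  apply: (@jump_within _ n G Y u g (p j) k K q (alpha j.-1) (alpha j) d) => //.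
  - clear -h1; lia.
  - clear -h2; lia.
  - by case/andP: jq.
  - by case/andP: jq.
  - apply: const_of_no_jump; first exact: ltnW (ltn_ord q).
    move=> i iq; apply/negP => /others; rewrite -val_eqE /= => /(_ _)/negP; apply.
      by clear -iq; lia.
    by clear -iq jq; lia.
  - move=> i iq; apply: (@const_of_no_jump _ n _ q (p j + 3 * k)) iq.
      by clear -h2; lia.
    move=> {}i iq; apply/negP => /others; rewrite -val_eqE /= => /(_ _)/negP; apply.
      by clear -iq; lia.
    by clear -iq jq; lia.
  - by move=> i ip; apply: h3; clear -ip; lia.
  - by move=> i ip; apply: h4; clear -ip; lia.
  - exact: jump_size.
split=> [j jD|i iu].
  have [|q qu qj] := @jump_detected u k j d (leqnn _) jD (ltW d_gt0) (jump_size jD).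
    apply: (le_lt_trans ug); rewrite expr_div_n -mulrA -subr_gt0 -mulrBr.
    by rewrite mulr_gt0 ?ltr0n//; have := exprn_gt0 2 d_gt0; lra.
  by exists q => //; exact: improve.
by have [j jD ij] := un _ iu; exists j => //; exact: improve.
Qed.

End Minimizer.
End Segmentation.

(** * Step functions, their jumps, and the Hausdorff distance *)

Section StepFunctions.
Context {R : realType}.
Implicit Types (alpha t : nat -> R).

Definition step_fun (m : nat) alpha t : R -> R :=
  fun x => \sum_(i < m) alpha i * \1_(`[t i, t i.+1[%classic) x.

Lemma grid_le m t i j : (forall l, (l < m)%N -> t l < t l.+1) ->
  (i <= j <= m)%N -> t i <= t j.
Proof.
move=> tS; elim: j => [|j IH]; first by rewrite leqn0 => /andP[/eqP->].
move=> /andP[]; rewrite leq_eqVlt => /orP[/eqP->//|ij jm].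
by apply: le_trans (ltW (tS _ jm)); apply: IH; rewrite -ltnS ij ltnW.
Qed.

Lemma step_value m alpha t j x : (forall l, (l < m)%N -> t l < t l.+1) ->
  (j < m)%N -> t j <= x < t j.+1 -> step_fun m alpha t x = alpha j.
Proof.
move=> tS jm /andP[jx xj]; rewrite /step_fun (bigD1 (Ordinal jm))//=.
rewrite indicE mem_set/= ?in_itv/= ?jx// mulr1 big1 ?addr0// => i.
rewrite -val_eqE /= => ij; rewrite indicE memNset ?mulr0//=.
rewrite in_itv/= => /andP[ix xi]; case: (ltngtP i j) ij => // ij _.
- have : t i.+1 <= t j by apply: (grid_le tS); rewrite ij ltnW.
  by move=> /(lt_le_trans xi)/lt_le_trans/(_ jx); rewrite ltxx.
- have : t j.+1 <= t i by apply: (grid_le tS); rewrite ij ltnW.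
  by move=> /(lt_le_trans xj)/lt_le_trans/(_ ix); rewrite ltxx.
Qed.

Lemma grid_cell_left m t x : t 0%N < x -> x <= t m ->
  exists2 j, (j < m)%N & t j < x <= t j.+1.
Proof.
move=> x0; elim: m => [|m IH]; first by rewrite leNgt x0.
move=> xm; have [/IH[j jm h]|mx] := leP x (t m).
  by exists j => //; exact: ltnW.
by exists m; rewrite ?mx.
Qed.

Lemma grid_cell_right m t x : t 0%N <= x -> x < t m ->
  exists2 j, (j < m)%N & t j <= x < t j.+1.
Proof.
move=> x0; elim: m => [|m IH]; first by rewrite ltNge x0.
move=> xm; have [/IH[j jm h]|mx] := ltP x (t m).
  by exists j => //; exact: ltnW.
by exists m; rewrite ?mx.
Qed.

Lemma step_left_lim m alpha t j x : (forall l, (l < m)%N -> t l < t l.+1) ->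
  (j < m)%N -> t j < x <= t j.+1 ->
  lim (step_fun m alpha t y @[y --> x^'-]) = alpha j.
Proof.
move=> tS jm /andP[jx xj]; apply/cvg_lim => //; apply: cvg_near_cst.
near=> y; apply: (step_value _ tS jm); apply/andP; split.
  by apply/ltW; near: y; exact: nbhs_left_gt.
by apply: lt_le_trans xj; near: y; exact: nbhs_left_lt.
Unshelve. all: by end_near. Qed.

Lemma step_right_lim m alpha t j x : (forall l, (l < m)%N -> t l < t l.+1) ->
  (j < m)%N -> t j <= x < t j.+1 ->
  lim (step_fun m alpha t y @[y --> x^'+]) = alpha j.
Proof.
move=> tS jm /andP[jx xj]; apply/cvg_lim => //; apply: cvg_near_cst.
near=> y; apply: (step_value _ tS jm); apply/andP; split.
  by apply: (le_trans jx); apply/ltW; near: y; exact: nbhs_right_gt.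
by near: y; exact: nbhs_right_lt.
Unshelve. all: by end_near. Qed.

(** Equal neighbouring levels are allowed in the representation and do not
    produce a jump. *)
Lemma jumps_step m alpha t : (forall l, (l < m)%N -> t l < t l.+1) ->
  t 0%N = 0 -> t m = 1 ->
  jumps (step_fun m alpha t) = [set t j | j in [set` jump_set alpha m]].
Proof.
move=> tS t0 tm; apply/seteqP; split=> [x [/andP[x0 x1]]|_ [j /= jD <-]].
- have [||j jm jx] := @grid_cell_left m t x; rewrite ?t0 ?tm ?(ltW x1)//.
  have [||i im ix] := @grid_cell_right m t x; rewrite ?t0 ?tm ?(ltW x0)//.
  rewrite (step_left_lim _ tS jm jx) (step_right_lim _ tS im ix) => ji.
  case/andP: jx => jx xj; case/andP: ix => ix xi.
  have iSj : i = j.+1.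
    have ij : (i <= j.+1)%N.
      rewrite leqNgt; apply/negP => ji'.
      have := tS _ (leq_trans ji' (ltnW im)); move: xj ix.
      have : t j.+2 <= t i by apply: (grid_le tS); rewrite ji' ltnW.
      by move=> a b c d; lra.
    apply/eqP; rewrite eqn_leq ij/= ltnNge; apply/negP => ij'.
    move: ij'; rewrite leq_eqVlt => /orP[/eqP E|ij']; first by rewrite E in ji.
    have : t i.+1 <= t j by apply: (grid_le tS); rewrite ij' ltnW.
    by move=> a; lra.
  subst i; exists (Ordinal im) => /=; last lra.
  by rewrite /= inE /=; apply/eqP.
- move: jD; rewrite inE => /andP[j0 ajj]; have jm := ltn_ord j.
  have tj0 : 0 < t j.
    rewrite -t0; apply: (lt_le_trans (tS 0%N _)); first exact: leq_trans jm.
    by apply: (grid_le tS); rewrite j0 ltnW.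
  have tj1 : t j < 1.
    rewrite -tm; apply: (lt_le_trans (tS _ jm)).
    by apply: (grid_le tS); rewrite jm leqnn.
  split; first by rewrite tj0.
  rewrite (@step_left_lim _ _ _ j.-1)//; last 2 first.
  + by rewrite prednK// ltnW.
  + by rewrite prednK// lexx andbT -{2}(prednK j0) tS// prednK// ltnW.
  by rewrite (step_right_lim _ tS jm) ?lexx ?tS//; exact/eqP.
Qed.

Lemma card_image_finset (I : finType) (A : {set I}) (F : I -> R) :
  {in A &, injective F} -> ([set F i | i in [set` A]] #= `I_#|A|)%card.
Proof.
move=> Finj; rewrite (_ : [set F i | i in [set` A]] = [set` [fset F i | i in A]%fset]).
  apply/card_eq_fsetP; rewrite card_in_imfset/=; first by rewrite cardE.
  by move=> i j; exact: Finj.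
apply/seteqP; split=> [_ [i iA <-]|_ /= /imfsetP[i iA ->]]/=.
  by apply/imfsetP; exists i.
by exists i.
Qed.

Lemma rhoH_le (A B : set R) r : 0 <= r ->
  (forall a, A a -> exists2 b, B b & `|b - a| <= r) ->
  (forall b, B b -> exists2 a, A a & `|b - a| <= r) -> rhoH A B <= r.
Proof.
move=> r0 AB BA; rewrite /rhoH; case: eqP => [A0|/eqP/set0P A0].
  case: eqP => // /eqP/set0P [b /BA[a]]; by rewrite A0.
case: eqP => [B0|/eqP/set0P B0].
  by have [a /AB[b]] := A0; rewrite B0.
rewrite ge_max; apply/andP; split; apply: ge_sup.
- by have [a Aa] := A0; exists (inf [set `|b - a| | b in B]), a.
- move=> _ [a Aa <-]; have [b Bb h] := AB _ Aa.
  apply: le_trans h; apply: ge_inf; last by exists b.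
  by exists 0 => _ [c _ <-].
- by have [b Bb] := B0; exists (inf [set `|b - a| | a in A]), b.
- move=> _ [b Bb <-]; have [a Aa h] := BA _ Bb.
  apply: le_trans h; apply: ge_inf; last by exists a.
  by exists 0 => _ [c _ <-].
Qed.

Lemma rhoH_ge0 (A B : set R) r :
  (forall a, A a -> exists2 b, B b & `|b - a| <= r) -> 0 <= rhoH A B.
Proof.
move=> AB; rewrite /rhoH; case: eqP => [_|/eqP/set0P A0]; first by case: eqP.
case: eqP => [//|/eqP/set0P B0].
rewrite le_max; apply/orP; left.
have [a Aa] := A0.
apply: (@le_trans _ _ (inf [set `|b - a| | b in B])).
  apply: lb_le_inf; last by move=> _ [b _ <-].
  by have [b Bb] := B0; exists `|b - a|, b.
apply: ub_le_sup; last by exists a.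
exists r => _ [c Ac <-]; have [b Bb h] := AB _ Ac.
apply: le_trans h; apply: ge_inf; last by exists b.
by exists 0 => _ [e _ <-].
Qed.

Lemma rhoH_unit (A B : set R) : A `<=` `]0, 1[ -> B `<=` `]0, 1[ ->
  0 <= rhoH A B <= 1.
Proof.
move=> A01 B01.
have dist a b : A a -> B b -> `|b - a| <= 1.
  by move=> /A01 + /B01; rewrite /= !in_itv/= ler_norml => /andP[? ?] /andP[? ?]; lra.
have [/eqP A0|/set0P[a Aa]] := boolP (A == set0).
  by rewrite /rhoH A0 eqxx; case: ifP; rewrite ?lexx ler01.
have [/eqP B0|/set0P[b Bb]] := boolP (B == set0).
  by rewrite /rhoH B0 eqxx; case: ifP; rewrite ?lexx ler01.
apply/andP; split.
  by apply: (@rhoH_ge0 _ _ 1) => c Ac; exists b => //; exact: dist.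
by apply: rhoH_le => // c Cc; [exists b|exists a] => //; exact: dist.
Qed.

End StepFunctions.

(** * Discretization: row vectors, cell averages, breakpoints *)

Section Vectors.
Context {R : realType}.

(** Row vectors become sequences, so that intervals of indices and the exchange
    of blocks need no bounds. *)
Definition ext0 n (u : 'rV[R]_n) (i : nat) : R := if insub i is Some j then u 0 j else 0.

Lemma extE n (u : 'rV[R]_n) (j : 'I_n) : ext0 u j = u 0 j.
Proof. by rewrite /ext0 valK. Qed.

Lemma ext_row n (h : nat -> R) i : (i < n)%N -> ext0 (\row_(j < n) h j) i = h i.
Proof. by move=> ni; rewrite -[i]/(val (Ordinal ni)) extE mxE. Qed.

Lemma embed_step n (u : 'rV[R]_n) : embed u = step_fun n (ext0 u) (design R n).
Proof. by apply/funext => x; apply: eq_bigr => i _; rewrite extE. Qed.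

Lemma num_jumps_njump n (u : 'rV[R]_n) : num_jumps u = njump (ext0 u) n.
Proof.
rewrite /num_jumps -cardsE /njump; apply/eqP; rewrite eqn_leq; apply/andP; split.
- have [] // := @matching _ _
    [set i : 'I_n | [exists j : 'I_n, (j == i.+1 :> nat) && (u 0 i != u 0 j)]]%SET
    (jump_set (ext0 u) n) (fun i j => j == i.+1 :> nat).
    move=> i; rewrite inE => /existsP[j /andP[/eqP ji uij]]; exists j; last exact/eqP.
    by rewrite inE ji /= -ji !extE.
  by move=> i i' j _ _ _ /eqP-> /eqP[/val_inj].
- have [] // := @matching _ _ (jump_set (ext0 u) n)
    [set i : 'I_n | [exists j : 'I_n, (j == i.+1 :> nat) && (u 0 i != u 0 j)]]%SET
    (fun j i => j == i.+1 :> nat).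
    move=> i; rewrite inE => /andP[i0 ui].
    have i1 : (i.-1 < n)%N by rewrite prednK// ltnW.
    exists (Ordinal i1); last by rewrite /= prednK.
    rewrite inE; apply/existsP; exists i; rewrite /= prednK// eqxx/=.
    by rewrite -!extE.
  by move=> i i' j _ _ _ /eqP E /eqP E'; apply: val_inj; rewrite /= E E'.
Qed.

Lemma potts_cost n gamma (Y u : 'rV[R]_n) : (0 < n)%N ->
  n%:R * potts gamma Y u = cost n (n%:R * gamma) (ext0 Y) (ext0 u).
Proof.
move=> n0; rewrite /potts /cost mulrDr mulVKf ?pnatr_eq0 -?lt0n// mulrA.
rewrite num_jumps_njump big_mkord; congr (_ + _).
by apply: eq_bigr => i _; rewrite !extE.
Qed.

Lemma eq_cost n G (Y u v : nat -> R) : (forall i, (i < n)%N -> u i = v i) ->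
  cost n G Y u = cost n G Y v.
Proof.
move=> uv; rewrite /cost; congr (_ + _ * _%:R).
  by apply: eq_big_nat => i /andP[_ /uv ->].
apply: eq_card => i; rewrite !inE !uv//.
by apply: leq_ltn_trans (ltn_ord i); exact: leq_pred.
Qed.

Lemma argmin_minimizer n gamma (Y u : 'rV[R]_n) : (0 < n)%N ->
  argmin (potts gamma Y) u -> minimizer n (n%:R * gamma) (ext0 Y) (ext0 u).
Proof.
move=> n0 umin v; rewrite -(eq_cost _ _ (@ext_row n v)) -!potts_cost//.
by rewrite ler_pM2l ?ltr0n//; exact: umin.
Qed.

Lemma jumps_embed n (u : 'rV[R]_n) : (0 < n)%N ->
  jumps (embed u) = [set design R n i | i in [set` jump_set (ext0 u) n]].
Proof.
move=> n0; rewrite embed_step; apply: jumps_step.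
- by move=> l _; rewrite /design ltr_pM2r ?ltr_nat// invr_gt0 ltr0n.
- by rewrite /design mul0r.
- by rewrite /design divff// pnatr_eq0 -lt0n.
Qed.

End Vectors.

Section MeanValue.
Context {R : realType}.

(** The right end point, at which a right-continuous function may leave the
    level of the cell, is negligible. *)
Lemma mean_close (f : R -> R) (a b c K B : R) : a < b ->
  measurable_fun setT f -> (forall x, `|f x| <= B) ->
  (forall x, a <= x < b -> `|f x - c| <= K) ->
  `|(b - a)^-1 * \int[lebesgue_measure]_(x in `[a, b]) f x - c| <= K.
Proof.
move=> ab mf fB fc; have ba : 0 < b - a by rewrite subr_gt0.
have muI : lebesgue_measure `[a, b[%classic = (b - a)%:E :> \bar R.
  by rewrite lebesgue_measure_itv/= lte_fin ab.
have int (h : R -> R) C : measurable_fun setT h -> (forall x, `|h x| <= C) ->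
    lebesgue_measure.-integrable `[a, b[%classic (EFin \o h).
  move=> mh hC; apply: measurable_bounded_integrable => //.
  - by apply: (@le_lt_trans _ _ (b - a)%:E); [rewrite -muI|exact: ltry].
  - exact: measurable_funTS.
  - exists C; split; first exact: num_real.
    by move=> y Cy x _; apply: le_trans (ltW Cy).
have icst e : lebesgue_measure.-integrable `[a, b[%classic (EFin \o (fun=> e : R)).
  by apply: (int _ `|e|).
rewrite -Rintegral_itv_bndo_bndc; last exact: (int f B).
set I := Rintegral _ _ _.
have cstI e : \int[lebesgue_measure]_(x in `[a, b[) e = e * (b - a).
  by rewrite Rintegral_cst//; congr (_ * _); apply: (congr1 fine muI).
have lo : (c - K) * (b - a) <= I.
  rewrite -cstI; apply: le_Rintegral => //; first exact: (int f B).
  by move=> x; rewrite /= in_itv/= => /fc; rewrite ler_norml => /andP[]; lra.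
have hi : I <= (c + K) * (b - a).
  rewrite -cstI; apply: le_Rintegral => //; first exact: (int f B).
  by move=> x; rewrite /= in_itv/= => /fc; rewrite ler_norml => /andP[]; lra.
rewrite mulrC ler_norml lerBrDr lerBlDr ler_pdivlMr// ler_pdivrMr//.
by apply/andP; split; lra.
Qed.

End MeanValue.

Section Discretization.
Context {R : realType} (m : nat) (alpha t : nat -> R).
Hypotheses (tS : forall l, (l < m)%N -> t l < t l.+1) (t0 : t 0%N = 0) (tm : t m = 1).

Let f := step_fun m alpha t.

Lemma measurable_step : measurable_fun setT f.
Proof.
apply: measurable_sum => i; apply: measurable_funM; first exact: measurable_cst.
exact: measurable_indic.
Qed.

Definition step_bound := \sum_(i < m) `|alpha i|.

Lemma step_bounded x : `|f x| <= step_bound.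
Proof.
apply: le_trans (ler_norm_sum _ _ _) _; apply: ler_sum => i _.
by rewrite normrM ler_piMr// indicE; case: (_ \in _); rewrite ?normr1 ?normr0.
Qed.

(** The first index whose design point is at or to the right of [t j]. *)
Definition breakpoint n j : nat := `|Num.ceil (n%:R * t j)|%N.

Lemma grid_ge0 j : (j <= m)%N -> 0 <= t j.
Proof. by move=> jm; rewrite -t0; apply: (grid_le tS). Qed.

Lemma breakpoint_leE n j i : (j <= m)%N -> (breakpoint n j <= i)%N = (n%:R * t j <= i%:R).
Proof.
move=> jm; have c0 : 0 <= Num.ceil (n%:R * t j).
  by rewrite ceil_ge0 (lt_le_trans (ltrN10 _))// mulr_ge0// grid_ge0.
rewrite -lez_nat gez0_abs//.
by rewrite ceil_le_int.
Qed.

Lemma breakpoint0 n : breakpoint n 0 = 0%N.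
Proof. by rewrite /breakpoint t0 mulr0 ceil0. Qed.

Lemma breakpoint_last n : breakpoint n m = n.
Proof. by rewrite /breakpoint tm mulr1 -[n%:R]/((n%:Z)%:~R) intrKceil. Qed.

Lemma breakpoint_itv n j : (j <= m)%N ->
  n%:R * t j <= (breakpoint n j)%:R < n%:R * t j + 1.
Proof.
move=> jm; rewrite -breakpoint_leE// leqnn /=.
case E : (breakpoint n j) => [|p].
  by apply: (@lt_le_trans _ _ 1) => //; rewrite lerDr mulr_ge0// grid_ge0.
by rewrite -natr1 ltrD2r ltNge -breakpoint_leE// E ltnn.
Qed.

Lemma breakpoint_gap n (k : nat) (e : R) : (forall j, (j < m)%N -> e <= t j.+1 - t j) ->
  (4 * k + 1)%:R <= n%:R * e ->
  forall j, (j < m)%N -> (breakpoint n j + 4 * k <= breakpoint n j.+1)%N.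
Proof.
move=> te ke j jm; have /andP[_ h1] := breakpoint_itv n (ltnW jm).
have /andP[h2 _] := breakpoint_itv n jm.
rewrite -(ler_nat R) natrD.
have := ler_wpM2l (ler0n R n) (te _ jm); rewrite natrD in ke.
by move: h1 h2 ke; rewrite mulrBr; move: ((4 * k)%:R : R) => K; lra.
Qed.

Lemma breakpoint_value n j i : (j < m)%N ->
  (breakpoint n j <= i < breakpoint n j.+1)%N -> f (design R n i) = alpha j.
Proof.
move=> jm; rewrite (ltnNge i) !breakpoint_leE ?(ltnW jm)// -ltNge => /andP[].
have [->|n0] := posnP n.
  by rewrite !mul0r => _; rewrite ltrn0.
have n0R : 0 < n%:R :> R by rewrite ltr0n.
move=> ji ij; apply: (step_value _ tS jm).
by rewrite /design ler_pdivlMr// ltr_pdivrMr// ![_ * n%:R]mulrC ji.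
Qed.

(** The cell average differs from the left end value only when a breakpoint lies
    strictly inside the cell or at its right end. *)
Lemma fbar_close n (i : 'I_n) : `|fbar f i - f (design R n i)| <=
  2 * step_bound * \sum_(j < m) (breakpoint n j.+1 == i.+1)%:R.
Proof.
have n0 : (0 < n)%N by case: n i => // -[].
have n0R : 0 < n%:R :> R by rewrite ltr0n.
have B0 : 0 <= step_bound by apply: sumr_ge0.
apply: (@mean_close _ _ _ _ _ _ step_bound).
- by rewrite /design ltr_pM2r ?ltr_nat// invr_gt0.
- exact: measurable_step.
- exact: step_bounded.
move=> x /andP[ix xi].
have ib : (i < breakpoint n m)%N by rewrite breakpoint_last.
have [j jm /andP[ji ij]] : exists2 j, (j < m)%N &
    (breakpoint n j <= i < breakpoint n j.+1)%N.
  have [||] := @grid_cell_right R m (fun j => (breakpoint n j)%:R) i%:R.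
  - by rewrite breakpoint0.
  - by rewrite breakpoint_last ltr_nat.
  - by move=> j jm; rewrite ler_nat ltr_nat => h; exists j.
have [E|N] := eqVneq (breakpoint n j.+1) i.+1.
  apply: (@le_trans _ _ (2 * step_bound * 1)); last first.
    rewrite ler_wpM2l ?mulr_ge0// (bigD1 (Ordinal jm))//= E eqxx lerDl.
    by apply: sumr_ge0.
  rewrite mulr1 mulr2n mulrDl mul1r; apply: (le_trans (ler_normB _ _)).
  by rewrite lerD ?step_bounded.
rewrite (breakpoint_value jm) ?ji//.
suff -> : f x = alpha j by rewrite subrr normr0 mulr_ge0 ?mulr_ge0//; apply: sumr_ge0.
apply: (step_value _ tS jm).
rewrite breakpoint_leE 1?ltnW// in ji.
have : ~~ (breakpoint n j.+1 <= i.+1)%N by rewrite -ltnNge ltn_neqAle eq_sym N ij.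
rewrite breakpoint_leE// -ltNge => ij'.
rewrite (le_trans _ ix) ?(lt_trans xi)//.
- by rewrite /design ltr_pdivrMr// mulrC.
- by rewrite /design ler_pdivlMr// mulrC.
Qed.

(** Each breakpoint spoils one cell, so the total averaging error is bounded
    independently of [n]. *)
Lemma fbar_bias n (a b : nat) : (b <= n)%N ->
  \sum_(a <= i < b) `|ext0 (\row_(i < n) fbar f i) i - f (design R n i)| <=
  2 * step_bound * m%:R.
Proof.
move=> bn; have B0 : 0 <= step_bound by apply: sumr_ge0.
pose F i : R := 2 * step_bound * \sum_(j < m) (breakpoint n j.+1 == i.+1)%:R.
have F0 i : 0 <= F i by rewrite !mulr_ge0// sumr_ge0.
apply: (@le_trans _ _ (\sum_(a <= i < b) F i)).
  apply: ler_sum_nat => i /andP[_ ib]; have ni := leq_trans ib bn.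
  by have := fbar_close (Ordinal ni); rewrite -[i]/(val (Ordinal ni)) extE mxE.
rewrite -mulr_sumr ler_wpM2l ?mulr_ge0// exchange_big/=.
rewrite -[m in m%:R]card_ord -sumr_const; apply: ler_sum => j _.
have [c|c] := boolP ((breakpoint n j.+1).-1 \in index_iota a b).
  rewrite (bigD1_seq _ c)//=; last exact: iota_uniq.
  rewrite big1 ?addr0; first by case: (_ == _).
  by move=> i ni; case: eqP => // E; move: ni; rewrite E /= eqxx.
rewrite big1_seq// => i /= ic; case: eqP => // E.
by rewrite E /= ic in c.
Qed.

End Discretization.

(** * Expectations of products of independent variables *)

Section WeightedExpectation.
Import HBNNSimple.
Local Open Scope ereal_scope.
Context d (T : measurableType d) (R : realType) (P : probability T R).

Let weighted_term_ge0 (W : T -> R) (X : T -> R) (h : {nnsfun R >-> R}) y w :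
  (0 <= W w)%R -> (0 <= y * (W w * \1_(h @^-1` [set y]) (X w)))%R.
Proof.
move=> W0; have := @nnfun_muleindic_ge0 _ _ _ h y (X w).
by rewrite -EFinM !lee_fin mulrCA => h0; rewrite mulr_ge0.
Qed.

Let measurable_weighted (W : T -> R) (X : T -> R) A :
  measurable_fun setT W -> measurable_fun setT X -> measurable A ->
  measurable_fun setT (fun w => (W w * \1_A (X w))%R).
Proof.
move=> mW mX mA; apply: measurable_funM => //.
by apply: (measurableT_comp _ mX); exact: measurable_indic.
Qed.

Lemma weighted_simple (W : T -> R) (X : T -> R) (h : {nnsfun R >-> R}) :
  measurable_fun setT W -> (forall w, (0 <= W w)%R) -> measurable_fun setT X ->
  \int[P]_w (W w * h (X w))%:E =
  \sum_(y \in range h) \int[P]_w (y * (W w * \1_(h @^-1` [set y]) (X w)))%:E.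
Proof.
move=> mW W0 mX; rewrite -ge0_integral_fsum//; last 2 first.
- move=> y; apply/measurable_EFinP; apply: measurable_funM => //.
  exact: measurable_weighted.
- by move=> y w _; rewrite lee_fin weighted_term_ge0.
apply: eq_integral => w _; rewrite fimfunE mulr_fsumr// -fsumEFin//.
by apply: eq_fsbigr => y _; rewrite mulrCA.
Qed.

(** If weighting by [W] multiplies the probability of every event about [X] by
    the constant [c], it multiplies the expectation of every nonnegative function
    of [X] by [c]: simple functions first, then monotone convergence. The right
    hand side is handled as the weight 1. *)
Lemma weighted_expectation (W : T -> R) (X : {RV P >-> R}) (f : R -> R) c :
  measurable_fun setT W -> (forall w, (0 <= W w)%R) ->
  measurable_fun setT f -> (forall x, (0 <= f x)%R) ->
  c \is a fin_num -> 0 <= c ->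
  (forall A, measurable A ->
     \int[P]_w (W w * \1_A (X w))%:E = c * P (X @^-1` A)) ->
  \int[P]_w (W w * f (X w))%:E = c * \int[P]_w (f (X w))%:E.
Proof.
move=> mW W0 mf f0 cfin c0 Wc.
have mEf : measurable_fun setT (EFin \o f) by apply/measurable_EFinP.
pose h := nnsfun_approx measurableT mEf.
have key (V : T -> R) : measurable_fun setT V -> (forall w, (0 <= V w)%R) ->
    \int[P]_w (V w * h n (X w))%:E @[n --> \oo] --> \int[P]_w (V w * f (X w))%:E.
  move=> mV V0.
  have -> : \int[P]_w (V w * f (X w))%:E =
            \int[P]_w limn (fun n => (V w * h n (X w))%:E).
    apply: eq_integral => w _; apply/esym/cvg_lim => //.
    under eq_fun do rewrite EFinM.
    rewrite EFinM; apply: cvgeZl => //.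
    by apply: (@cvg_nnsfun_approx _ _ _ _ measurableT _ mEf) => // y _; rewrite lee_fin.
  apply: cvg_monotone_convergence => //.
  - move=> n; apply/measurable_EFinP; apply: measurable_funM => //.
    by apply: (measurableT_comp (measurable_funPT (h n)) (measurable_funPT X)).
  - by move=> n w _; rewrite lee_fin mulr_ge0.
  - move=> w _ n k nk; rewrite lee_fin ler_wpM2l//.
    by move: (X w); apply/lefP; exact: nd_nnsfun_approx.
have m1 : measurable_fun [set: T] ((fun=> 1%R) : T -> R) by exact: measurable_cst.
have k1 := key W mW W0.
have k2 := cvgeZl cfin (key (fun=> 1%R) m1 (fun=> ler01)).
under [in RHS]eq_integral do rewrite -[f _]mul1r.
rewrite -(cvg_lim _ k1)// -(cvg_lim _ k2)//; congr (limn _); apply/funext => n.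
have mX := measurable_funPT X.
rewrite !weighted_simple//.
rewrite ge0_mule_fsumr; last first.
  move=> y; apply: integral_ge0 => w _; rewrite lee_fin.
  exact: (@weighted_term_ge0 (fun=> 1%R)).
apply: eq_fsbigr => y /set_mem[x _ <-].
have mA : measurable (h n @^-1` [set h n x]) by [].
have pull (V : T -> R) : measurable_fun setT V -> (forall w, (0 <= V w)%R) ->
    \int[P]_w (h n x * (V w * \1_(h n @^-1` [set h n x]) (X w)))%:E =
    (h n x)%:E * \int[P]_w (V w * \1_(h n @^-1` [set h n x]) (X w))%:E.
  move=> mV V0; under eq_integral do rewrite EFinM.
  rewrite ge0_integralZl_EFin//.
  - by move=> w _; rewrite lee_fin mulr_ge0.
  - by apply/measurable_EFinP; exact: measurable_weighted.
rewrite pull// (pull (fun=> 1%R))// Wc// muleCA; congr (_ * (_ * _)).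
under eq_integral do rewrite mul1r.
have : measurable (X @^-1` (h n @^-1` [set h n x])).
  by rewrite -[X in measurable X]setTI; exact: mX.
move=> /(integral_indic P measurableT); rewrite setIT => <-.
by apply: eq_integral.
Qed.

End WeightedExpectation.

Section IndependentProducts.
Local Open Scope ereal_scope.
Context d (T : measurableType d) (R : realType) (P : probability T R).
Context (I : finType) (X : I -> {RV P >-> R}).
Hypothesis Xind : mutually_independent X.

Lemma expectation_indic (Y : {RV P >-> R}) A : measurable A ->
  \int[P]_w (\1_A (Y w))%:E = P (Y @^-1` A).
Proof.
move=> mA; have : measurable (Y @^-1` A).
  by rewrite -[X in measurable X]setTI; exact: (measurable_funPT Y).
move=> /(integral_indic P measurableT); rewrite setIT => <-.
by apply: eq_integral.
Qed.

Lemma independent_indic (A : I -> set R) : (forall i, measurable (A i)) ->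
  \int[P]_w (\prod_i \1_(A i) (X i w))%R%:E = \prod_i P (X i @^-1` A i).
Proof.
move=> mA; have := Xind (J := [set: I]%SET) (A := A) (fun i _ => mA i).
have -> : [set` [set: I]%SET] = [set: I] :> set I by apply/seteqP; split => // i _ /=; rewrite inE.
under [in X in _ = X -> _]eq_bigl do rewrite inE.
move=> <-; have mcap : measurable (\bigcap_(i in [set: I]) X i @^-1` A i).
  apply: fin_bigcap_measurable => [|i _]; first exact: finite_finset.
  by rewrite -[X in measurable X]setTI; exact: (measurable_funPT (X i)).
have := integral_indic P measurableT mcap; rewrite setIT => <-.
apply: eq_integral => w _; congr EFin; rewrite indicE.
have [/set_mem wA|wA] := boolP (w \in _).
  by rewrite big1// => i _; rewrite indicE mem_set//; exact: wA.
have [i wi] : exists i, ~ (A i) (X i w).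
  by apply/existsNP => h; move: wA; rewrite mem_set// => i _; exact: h.
by rewrite (bigD1 i)//= indicE memNset// mul0r.
Qed.

(** Induction on the number of factors that are not indicators: exchange one such
    factor for an arbitrary indicator, where the factorization is known, and
    conclude with [weighted_expectation], the other factors being the weight. *)
Lemma independent_expectation (phi : I -> R -> R) :
  (forall i, measurable_fun setT (phi i)) -> (forall i x, (0 <= phi i x)%R) ->
  (forall i, \int[P]_w (phi i (X i w))%:E < +oo) ->
  \int[P]_w (\prod_i phi i (X i w))%R%:E = \prod_i \int[P]_w (phi i (X i w))%:E.
Proof.
suff key (k : nat) (S : {set I}) : #|S| = k -> forall psi : I -> R -> R,
    (forall i, measurable_fun setT (psi i)) -> (forall i x, (0 <= psi i x)%R) ->
    (forall i, \int[P]_w (psi i (X i w))%:E < +oo) ->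
    (forall i, i \notin S -> exists2 A, measurable A & psi i = \1_A) ->
    \int[P]_w (\prod_i psi i (X i w))%R%:E = \prod_i \int[P]_w (psi i (X i w))%:E.
  by move=> mphi phi0 phioo; apply: (key _ [set: I]%SET erefl) => // i; rewrite inE.
elim: k S => [|k IH] S Sk psi mpsi psi0 psioo psiA.
  have /choice[A HA] : forall i, exists A : set R, measurable A /\ psi i = \1_A.
    move=> i; have [|A mA E] := psiA i; first by rewrite (cards0_eq Sk) inE.
    by exists A.
  have mA i := (HA i).1; have EA i := (HA i).2.
  under eq_integral do under eq_bigr do rewrite EA.
  rewrite independent_indic//; apply: eq_bigr => i _.
  by under eq_integral do rewrite EA; rewrite expectation_indic.
have [i iS] : exists i, i \in S by apply/set0Pn; rewrite -card_gt0 Sk.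
pose W w : R := (\prod_(j | j != i) psi j (X j w))%R.
under eq_integral => w _.
  rewrite (bigD1 i)//= mulrC -/(W w); over.
rewrite [RHS](bigD1 i)//= muleC.
have int0 (j : I) : 0 <= \int[P]_w (psi j (X j w))%:E.
  by apply: integral_ge0 => w _; rewrite lee_fin.
apply: weighted_expectation => //.
- have -> : W = fun w => (\prod_(j <- [seq j <- index_enum I | j != i]) psi j (X j w))%R.
    by apply/funext => w; rewrite big_filter.
  apply: measurable_prod => j _.
  exact: (measurableT_comp (mpsi j) (measurable_funPT (X j))).
- by move=> w; apply: prodr_ge0.
- apply: (big_ind (fun x => x \is a fin_num)) => //.
    by move=> x y; exact: fin_numM.
  by move=> j _; rewrite ge0_fin_numE.
- by apply: prode_ge0.
move=> A mA.
pose psi' j := if j == i then (\1_A : R -> R) else psi j.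
have psi'i : psi' i = \1_A by rewrite /psi' eqxx.
have psi'j j : j != i -> psi' j = psi j by rewrite /psi' => /negbTE->.
have E : \int[P]_w (\prod_j psi' j (X j w))%R%:E =
         \prod_j \int[P]_w (psi' j (X j w))%:E.
  apply: (IH (S :\ i)%SET).
  - by move: Sk; rewrite (cardsD1 i) iS add1n => -[].
  - move=> j; rewrite /psi'; case: eqP => _ //; exact: measurable_indic.
  - by move=> j x; rewrite /psi'; case: eqP => // _; rewrite indicE.
  - move=> j; have [->|ji] := eqVneq j i; last by rewrite psi'j.
    rewrite psi'i expectation_indic//.
    apply: le_lt_trans (probability_le1 _ _) (ltry _).
    by rewrite -[X in measurable X]setTI; exact: (measurable_funPT (X i)).
  - move=> j; have [->|ji] := eqVneq j i; first by move=> _; exists A.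
    by rewrite psi'j// => jS; apply: psiA; move: jS; rewrite !inE ji.
rewrite [RHS](bigD1 i)//= psi'i expectation_indic// [RHS]muleC in E.
transitivity (\int[P]_w (\prod_j psi' j (X j w))%R%:E).
  apply: eq_integral => w _; rewrite (bigD1 i)//= psi'i mulrC; congr (_ * _)%R%:E.
  by apply: eq_bigr => j ji; rewrite psi'j.
rewrite E; congr (_ * _); apply: eq_bigr => j ji.
by apply: eq_integral => w _; rewrite psi'j.
Qed.

End IndependentProducts.

(** * Exponential bounds for sums of the noise *)

Section Probability.
Context d (T : measurableType d) (R : realType) (P : probability T R).

(** Chernoff bound at the optimal [nu = t / (2 v)], applied to [S] and [- S]. *)
Lemma subgaussian_tail (S : T -> R) (v t : R) : measurable_fun setT S -> 0 < v ->
  (forall nu, 'M_P S nu <= (expR (v * nu ^+ 2))%:E)%E -> 0 <= t ->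
  (P [set w | (t <= `|S w|)%R] <= (2 * expR (- (t ^+ 2 / (4 * v))))%:E)%E.
Proof.
move=> mS v0 mgf; rewrite le_eqVlt => /predU1P[<-|t0].
  rewrite expr0n mul0r oppr0 expR0 mulr1.
  have m : measurable [set w | 0 <= `|S w|].
    by rewrite (_ : [set w | _] = setT)//; apply/seteqP; split => // w _; exact: normr_ge0.
  by apply: (le_trans (probability_le1 P m)); rewrite lee_fin ler1n.
have mle (Z : T -> R) : measurable_fun setT Z -> measurable [set w | t <= Z w].
  by move=> mZ; rewrite -[X in measurable X]setTI; exact: measurable_fun_le.
have half (Z : T -> R) : measurable_fun setT Z ->
    (forall nu, 'M_P Z nu <= (expR (v * nu ^+ 2))%:E)%E ->
    (P [set w | (t <= Z w)%R] <= (expR (- (t ^+ 2 / (4 * v))))%:E)%E.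
  move=> mZ mgfZ.
  pose X : {RV P >-> R} := HB.pack Z (@isMeasurableFun.Build _ _ _ _ Z mZ).
  have nu0 : 0 < t / (2 * v) by rewrite divr_gt0// mulr_gt0.
  apply: (le_trans (@chernoff _ _ _ P X _ t nu0)).
  apply: (@le_trans _ _ ((expR (v * (t / (2 * v)) ^+ 2))%:E *
                         (expR (- (t / (2 * v) * t)))%:E)%E).
    by rewrite lee_wpmul2r ?mgfZ// lee_fin expR_ge0.
  rewrite -EFinM -expRD lee_fin ler_expR le_eqVlt; apply/orP; left; apply/eqP.
  by field; rewrite gt_eqF.
have mN : measurable_fun setT (fun w => - S w) by exact: measurableT_comp.
have -> : [set w | t <= `|S w|] = [set w | t <= S w] `|` [set w | t <= - S w].
  by apply/seteqP; split=> w /=; rewrite ler_normr => /orP.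
apply: (le_trans (measureU2 P (mle _ mS) (mle _ mN))).
rewrite mulr2n mulrDl mul1r EFinD leeD ?half// => nu.
have -> : 'M_P (fun w => - S w) nu = 'M_P S (- nu).
  by congr expectation; apply/funext => w /=; rewrite mulNr mulrN.
by rewrite -sqrrN.
Qed.

Lemma measure_bigsetU_le n (A : nat -> set T) (e : nat -> R) :
  (forall i, (i < n)%N -> measurable (A i)) ->
  (forall i, (i < n)%N -> P (A i) <= (e i)%:E)%E ->
  (P (\big[setU/set0]_(i < n) A i) <= (\sum_(i < n) e i)%:E)%E.
Proof.
move=> mA Ae; apply: (le_trans (Boole_inequality P mA)).
by rewrite -sumEFin; apply: lee_sum => i _; exact: Ae.
Qed.

Lemma mem_bigsetU n (F : nat -> set T) i w : (i < n)%N -> F i w ->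
  (\big[setU/set0]_(i < n) F i) w.
Proof. by move=> ni Fw; rewrite -bigcup_mkord; exists i. Qed.

Lemma borel_cantelli_eventually (B : nat -> set T) (C : R) :
  (forall n, measurable (B n)) ->
  (forall n, \sum_(0 <= i < n) P (B i) <= C%:E)%E ->
  {ae P, forall w, \forall n \near \oo, ~ B n w}.
Proof.
move=> mB BC; exists (lim_sup_set B); split.
- apply: bigcap_measurable => // n _.
  by apply: bigcup_measurable => k _; exact: mB.
- apply: lim_sup_set_cvg0 => //; apply: (@le_lt_trans _ _ C%:E); last exact: ltry.
  apply: lime_le; first exact: is_cvg_nneseries.
  by apply: nearW => n; exact: BC.
- move=> w nB n _; apply: contrapT => no; apply: nB; exists n => // k /= nk Bk.
  by apply: no; exists k.
Qed.

(** Continuity from above along the unions of the tails, whose intersection is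
    null. *)
Lemma eventually_never_small (B : nat -> set T) (eps : R) :
  (forall n, measurable (B n)) -> 0 < eps ->
  {ae P, forall w, \forall n \near \oo, ~ B n w} ->
  exists N, forall n, (N <= n)%N -> (P (B n) <= eps%:E)%E.
Proof.
move=> mB eps0 [Z [mZ PZ BZ]].
have mU n : measurable (\bigcup_(k >= n) B k) by exact: bigcup_measurable.
have mL : measurable (lim_sup_set B) by apply: bigcap_measurable.
have LZ : lim_sup_set B `<=` Z.
  move=> w wL; apply: BZ => -[n _ nB].
  by have [k nk Bk] := wL n Logic.I; exact: (nB k nk).
have PL : P (lim_sup_set B) = 0%E.
  apply/eqP; rewrite eq_le measure_ge0 andbT -PZ.
  by apply: le_measure => //; exact/mem_set.
have limP x : P (lim_sup_set B) = x -> P (\bigcup_(k >= n) B k) @[n --> \oo] --> x.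
  move=> <-; apply: lim_sup_set_cvg => //.
  exact: le_lt_trans (probability_le1 _ (mU 0%N)) (ltry _).
have /fine_cvgP[_ /cvgrPdist_lt/(_ _ eps0)[N _ HN]] := limP _ PL.
exists N => n Nn; have := HN n Nn; rewrite /= sub0r normrN => h.
apply: (@le_trans _ _ (P (\bigcup_(k >= n) B k))).
  by apply: le_measure; [exact/mem_set|exact/mem_set|by apply: bigcup_sup => /=].
rewrite -[leLHS]fineK ?fin_num_measure// lee_fin ltW//.
by apply: le_lt_trans h; exact: ler_norm.
Qed.

Context (xi : forall n, 'I_n -> {RV P >-> R}) (beta : R).
Arguments xi : clear implicits.
Hypotheses (xi_ind : forall n, mutually_independent (xi n)) (beta_gt0 : 0 < beta).
Hypothesis xi_mgf : forall n (i : 'I_n) nu,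
  ('M_P (xi n i) nu <= (expR (beta * nu ^+ 2))%:E)%E.

Definition noise_sum n a b w := \sum_(a <= i < b) ext0 (\row_(j < n) xi n j w) i.

Lemma noise_sumE n a b w : (b <= n)%N ->
  noise_sum n a b w = \sum_(i < n) (if (a <= i < b)%N then xi n i w else 0).
Proof.
move=> bn; rewrite /noise_sum (@big_nat_widenl _ _ _ a 0%N)//
  (@big_nat_widen _ _ _ 0%N b n)// big_mkord.
rewrite big_mkcond/=; apply: eq_bigr => i _; rewrite extE mxE.
by rewrite andbC.
Qed.

Lemma measurable_noise_sum n a b : (b <= n)%N -> measurable_fun setT (noise_sum n a b).
Proof.
move=> bn; have -> : noise_sum n a b =
    fun w => \sum_(i < n) (if (a <= i < b)%N then xi n i w else 0).
  by apply/funext => w; exact: noise_sumE.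
apply: measurable_sum => i; case: (a <= i < b)%N; last exact: measurable_cst.
exact: measurable_funPT.
Qed.

(** The sum over an interval is treated as a product over all indices in which
    the factors outside the interval are 1. *)
Lemma noise_sum_mgf n a b nu : (a <= b <= n)%N ->
  ('M_P (noise_sum n a b) nu <= (expR ((beta * (b - a)%:R) * nu ^+ 2))%:E)%E.
Proof.
move=> /andP[ab bn].
pose phi (i : 'I_n) (x : R) := if (a <= i < b)%N then expR (x * nu) else 1.
have phi_le i : (\int[P]_w (phi i (xi n i w))%:E <=
    (if (a <= i < b)%N then expR (beta * nu ^+ 2) else 1)%:E)%E.
  rewrite /phi; case: ifP => _.
    by have := xi_mgf i nu; rewrite /mmt_gen_fun unlock.
  by rewrite integral_cst// mul1e; exact: probability_le1.
rewrite /mmt_gen_fun unlock.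
have -> : (\int[P]_w ((expR \o nu \o* noise_sum n a b) w)%:E)%E =
          (\int[P]_w (\prod_(i < n) phi i (xi n i w))%:E)%E.
  apply: eq_integral => w _; congr EFin; rewrite /= noise_sumE// mulr_suml expR_sum.
  by apply: eq_bigr => i _; rewrite /phi; case: ifP; rewrite ?mul0r ?expR0.
rewrite independent_expectation//.
- apply: (@le_trans _ _ (\prod_(i < n)
    (if (a <= i < b)%N then expR (beta * nu ^+ 2) else 1)%:E)%E).
    apply: (@proj2 (0 <= \prod_(i < n) \int[P]_w (phi i (xi n i w))%:E)%E).
    apply: (big_ind2 (fun x y => 0 <= x /\ x <= y)%E) => //.
      by move=> x1 x2 y1 y2 [? ?] [? ?]; rewrite mule_ge0// lee_pmul.
    move=> i _; split; last exact: phi_le.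
    apply: integral_ge0 => w _; rewrite lee_fin /phi; case: ifP => // _.
  rewrite prodEFin lee_fin -big_mkcond/= -expR_sum ler_expR.
  rewrite (_ : \sum_(i < n | _) _ = \sum_(a <= i < b) beta * nu ^+ 2).
    by rewrite sum_nat_const_interval; lra.
  rewrite (@big_nat_widenl _ _ _ a 0%N)//
  (@big_nat_widen _ _ _ 0%N b n)// big_mkord.
  by apply: eq_bigl => i; rewrite andbC.
- move=> i; rewrite /phi; case: (a <= i < b)%N; last exact: measurable_cst.
  by apply: measurableT_comp => //; exact: mulrr_measurable.
- by move=> i x; rewrite /phi; case: ifP => // _; exact: expR_ge0.
- by move=> i; apply: le_lt_trans (phi_le i) (ltry _).
Qed.

Lemma noise_sum_tail n a b t : (a < b <= n)%N -> 0 <= t ->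
  (P [set w | (t <= `|noise_sum n a b w|)%R] <=
     (2 * expR (- (t ^+ 2 / (4 * (beta * (b - a)%:R)))))%:E)%E.
Proof.
move=> /andP[ab bn] t0; apply: subgaussian_tail => //.
- exact: measurable_noise_sum.
- by rewrite mulr_gt0// ltr0n subn_gt0.
- by move=> nu; apply: noise_sum_mgf; rewrite ltnW.
Qed.

Lemma measurable_noise_ge n a b t : (b <= n)%N ->
  measurable [set w | t <= `|noise_sum n a b w|].
Proof.
move=> bn; rewrite -[X in measurable X]setTI; apply: measurable_fun_le => //.
by apply: measurableT_comp => //; exact: measurable_noise_sum.
Qed.

(** The level [16 beta log n] bounds the probability of each interval by
    [2 n^-4], which remains summable after the union over the intervals. *)
Definition loud_interval n a b : set T :=
  if (a < b <= n)%N then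
    [set w | Num.sqrt (16 * beta * ln n%:R * (b - a)%:R) <= `|noise_sum n a b w|]
  else set0.

Definition loud n : set T :=
  \big[setU/set0]_(a < n.+1) \big[setU/set0]_(b < n.+1) loud_interval n a b.

Lemma measurable_loud_interval n a b : measurable (loud_interval n a b).
Proof.
rewrite /loud_interval; case: ifP => // /andP[_ bn].
exact: measurable_noise_ge.
Qed.

Lemma measurable_loud n : measurable (loud n).
Proof.
by apply: bigsetU_measurable => a _; apply: bigsetU_measurable => b _;
  exact: measurable_loud_interval.
Qed.

Lemma not_loud n w : ~ loud n w ->
  noise_bound (ext0 (\row_(j < n) xi n j w)) n (16 * beta * ln n%:R).
Proof.
move=> nl a b abn; have /andP[ab bn] := abn.
have n0 : (0 < n)%N by apply: leq_trans bn; apply: leq_ltn_trans ab.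
have M0 : 0 <= 16 * beta * ln n%:R * (b - a)%:R :> R.
  by rewrite !mulr_ge0 ?ln_ge0 ?ler1n// ltW.
have : ~ loud_interval n a b w.
  apply: contra_not nl => h; have an : (a < n.+1)%N by rewrite ltnS ltnW// (leq_trans ab).
  apply: (@mem_bigsetU _ (fun a => \big[setU/set0]_(b < n.+1) loud_interval n a b) a) => //.
  exact: (@mem_bigsetU _ (loud_interval n a) b).
rewrite /loud_interval abn /= => /negP; rewrite -ltNge => h.
rewrite -[leRHS]sqr_sqrtr// -[leLHS]real_normK ?num_real//.
by rewrite ler_pXn2r ?nnegrE ?sqrtr_ge0// ltW.
Qed.

Lemma loud_interval_prob n a b : (0 < n)%N ->
  (P (loud_interval n a b) <= (2 / n%:R ^+ 4)%:E)%E.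
Proof.
move=> n0; have n0R : 0 < n%:R :> R by rewrite ltr0n.
rewrite /loud_interval; case: ifP => [abn|_]; last first.
  by rewrite measure0 lee_fin divr_ge0// exprn_ge0// ltW.
apply: (le_trans (noise_sum_tail abn (sqrtr_ge0 _))); rewrite lee_fin.
have L0 : 0 < (b - a)%:R :> R by rewrite ltr0n subn_gt0; case/andP: abn.
rewrite sqr_sqrtr; last by rewrite !mulr_ge0 ?ln_ge0 ?ler1n// ltW.
have -> : 16 * beta * ln n%:R * (b - a)%:R / (4 * (beta * (b - a)%:R)) = ln n%:R *+ 4 :> R.
  by rewrite -mulr_natr; field; rewrite gt_eqF//= gt_eqF.
by rewrite expRN -[_ *+ 4]mulr_natl expRM_natl lnK// posrE.
Qed.

(** The union runs over [(n + 1)^2] pairs, and the bound is chosen so that its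
    partial sums telescope. *)
Lemma loud_prob n : (P (loud n) <= (16 / (n%:R * n.+1%:R))%:E)%E.
Proof.
have [->|n0] := posnP n.
  rewrite mul0r invr0 mulr0 /loud !big_ord_recl !big_ord0 !setU0.
  by rewrite /loud_interval /= measure0.
apply: (@le_trans _ _ (\sum_(a < n.+1) \sum_(b < n.+1) (2 / n%:R ^+ 4))%:E).
  apply: (@measure_bigsetU_le _
    (fun a => \big[setU/set0]_(b < n.+1) loud_interval n a b)
    (fun=> \sum_(b < n.+1) (2 / n%:R ^+ 4))) => a _.
    by apply: bigsetU_measurable => b _; exact: measurable_loud_interval.
  apply: (@measure_bigsetU_le _ (loud_interval n a) (fun=> 2 / n%:R ^+ 4)) => b _.
    exact: measurable_loud_interval.
  exact: loud_interval_prob.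
have -> : \sum_(a < n.+1) \sum_(b < n.+1) (2 / n%:R ^+ 4) =
          n.+1%:R * (n.+1%:R * (2 / n%:R ^+ 4)) :> R.
  by rewrite !sumr_const card_ord !mulr_natl.
rewrite lee_fin.
have n1 : 1 <= n%:R :> R by rewrite ler1n.
rewrite -natr1; move: n1; move: (n%:R : R) => x x1.
have x0 : x != 0 by rewrite gt_eqF//; lra.
have x10 : x + 1 != 0 by rewrite gt_eqF//; lra.
rewrite -subr_ge0 (_ : _ - _ = (2 * (8 * x ^+ 3 - (x + 1) ^+ 3)) / (x ^+ 4 * (x + 1))).
  have xp : 0 <= x by lra.
  have x1p : 0 <= x + 1 by lra.
  rewrite divr_ge0 ?mulr_ge0 ?exprn_ge0// subr_ge0.
  rewrite (_ : 8 * x ^+ 3 = (2 * x) ^+ 3); last by ring.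
  by rewrite lerXn2r ?nnegrE//; lra.
by field; rewrite x0 x10.
Qed.

Lemma eventually_not_loud : {ae P, forall w, \forall n \near \oo, ~ loud n w}.
Proof.
apply: (@borel_cantelli_eventually loud 16); first exact: measurable_loud.
case=> [|n]; first by rewrite big_geq.
apply: (@le_trans _ _ (16 * (1 - n.+1%:R^-1))%:E); last first.
  by rewrite lee_fin ler_piMr// gerBl.
elim: n => [|n IH].
  rewrite big_nat1 invr1 subrr mulr0.
  by apply: (le_trans (loud_prob 0)); rewrite mul0r invr0 mulr0.
rewrite big_nat_recr//=; apply: (le_trans (leeD IH (loud_prob _))).
rewrite -EFinD lee_fin -!natr1; have : 0 <= n%:R :> R by [].
move: (n%:R : R) => x x0; rewrite le_eqVlt; apply/orP; left; apply/eqP.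
by field; rewrite !gt_eqF//; lra.
Qed.

(** Intervals of length [l >= K] whose starting point depends on [l]: a constant
    [s] gives the intervals starting at a fixed index, and [s l = p - l] those
    ending at [p]. *)
Definition drift (eta : R) n (s : nat -> nat) K : set T :=
  \big[setU/set0]_(l < n.+1)
    if (K <= l)%N && (s l + l <= n)%N then
      [set w | eta * l%:R <= `|noise_sum n (s l) (s l + l) w|] else set0.

Lemma measurable_drift eta n s K : measurable (drift eta n s K).
Proof.
apply: bigsetU_measurable => l _; case: ifP => // /andP[_ sn].
exact: measurable_noise_ge.
Qed.

Lemma not_drift eta n s K l w : ~ drift eta n s K w -> (K <= l)%N ->
  (s l + l <= n)%N -> `|noise_sum n (s l) (s l + l) w| <= eta * l%:R.
Proof.
move=> nd Kl sn; rewrite leNgt; apply/negP => h; apply: nd.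
have ln : (l < n.+1)%N by rewrite ltnS (leq_trans _ sn)// leq_addl.
apply: (@mem_bigsetU _ (fun l => if (K <= l)%N && (s l + l <= n)%N then
  [set w | eta * l%:R <= `|noise_sum n (s l) (s l + l) w|] else set0) l) => //.
by rewrite Kl sn /= ltW.
Qed.

Definition drift_rate eta := expR (- (eta ^+ 2 / (4 * beta))).

(** A noise sum over [l] indices exceeds [eta l] with probability at most
    [2 r^l]; the bound is the sum of the geometric tail. *)
Lemma drift_prob eta n s K : 0 < eta -> (0 < K)%N ->
  (P (drift eta n s K) <=
    (2 * (drift_rate eta ^+ K / (1 - drift_rate eta)))%:E)%E.
Proof.
move=> eta0 K0; set r := drift_rate eta.
have r0 : 0 < r by exact: expR_gt0.
have r1 : r < 1.
  by rewrite /r /drift_rate expR_lt1 oppr_lt0 divr_gt0 ?exprn_gt0 ?mulr_gt0.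
pose e l := if (K <= l)%N then 2 * r ^+ l else 0.
apply: (@le_trans _ _ (\sum_(l < n.+1) e l)%:E).
  apply: (@measure_bigsetU_le _ (fun l => if (K <= l)%N && (s l + l <= n)%N then
      [set w | eta * l%:R <= `|noise_sum n (s l) (s l + l) w|] else set0)) => l _.
    by case: ifP => // /andP[_ sn]; exact: measurable_noise_ge.
  rewrite /e; case: ifP => [/andP[Kl sn]|_]; last first.
    by rewrite measure0; case: ifP; rewrite lee_fin// mulr_ge0// exprn_ge0// ltW.
  rewrite Kl; have l0 : (0 < l)%N by exact: leq_trans Kl.
  apply: (le_trans (@noise_sum_tail _ _ _ _ _ _)).
  - by rewrite sn andbT -addn1 leq_add2l.
  - by rewrite mulr_ge0// ltW.
  rewrite lee_fin ler_pM2l// addKn /r /drift_rate -expRM_natl ler_expR.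
  have : 0 < l%:R :> R by rewrite ltr0n.
  move: (l%:R : R) => x x0.
  by rewrite le_eqVlt; apply/orP; left; apply/eqP; field; rewrite !gt_eqF.
rewrite lee_fin -(big_mkord xpredT e).
(* The second power is the tail beyond [N]; no term has been summed if [N < K]. *)
have key N : \sum_(0 <= l < N) e l <=
    2 * ((r ^+ K - (if (K <= N)%N then r ^+ N else r ^+ K)) / (1 - r)).
  have r1' : 1 - r != 0 by rewrite subr_eq0 gt_eqF.
  elim: N => [|N IH].
    by rewrite big_geq// leqn0 eqn0Ngt K0/= subrr mul0r mulr0.
  rewrite big_nat_recr//=; apply: (le_trans (lerD IH (lexx _))); rewrite /e.
  have [KN|NK] := leqP K N.
    rewrite leqW// exprS le_eqVlt; apply/orP; left; apply/eqP.
    by field.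
  rewrite addr0; case: ifP => // KN.
  by have -> : K = N.+1 by apply/eqP; rewrite eqn_leq KN.
apply: (le_trans (key _)); rewrite ler_pM2l// ler_pM2r ?invr_gt0 ?subr_gt0//.
by rewrite gerBl; case: ifP => _; rewrite exprn_ge0// ltW.
Qed.

End Probability.

(** * Recovery of the jumps from one quiet sample *)

(** Everything here concerns one realization at one sample size. [L] stands for
    [log n] and [x] for the noise values; [penalty_floor] and [penalty_ceiling]
    delimit the penalties for which [minimizer_matching] applies, with windows
    of about [n lam / 8] indices. *)
Section Recovery.
Context {R : realType} (m : nat) (alpha t : nat -> R) (lam del b : R).
Hypotheses (tS : forall l, (l < m)%N -> t l < t l.+1) (t0 : t 0%N = 0) (tm : t m = 1).
Hypotheses (lam_gt0 : 0 < lam) (del_gt0 : 0 < del) (b_ge0 : 0 <= b).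
Hypothesis t_gap : forall j, (j < m)%N -> lam <= t j.+1 - t j.
Hypothesis jump_size :
  forall j : 'I_m, j \in jump_set alpha m -> del <= `|alpha j.-1 - alpha j|.

Let f := step_fun m alpha t.
Let J := njump alpha m.
Let bias := 2 * step_bound m alpha * m%:R.

(** From [(s + bias)^2 <= 2 s^2 + 2 bias^2]; an interval has at least one index
    and [L >= 1], so [bias^2] is at most [bias^2 L] times its length. *)
Definition total_noise := 2 * b + 2 * bias ^+ 2.
Definition penalty_floor := 4 * total_noise * (J%:R + 1).
(** The constant 4096 serves two ends: it makes the penalty small for windows of
    [n lam / 16] indices, and, since the noise level is below the penalty, it
    also makes the noise small enough for the local exchange argument. *)
Definition penalty_ceiling := lam * del ^+ 2 / (4096 * (J%:R + 1)).
Definition rate_constant := 8 * total_noise * (2 * J%:R + 1) / del ^+ 2 + 1.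

Let bias_ge0 : 0 <= bias.
Proof. by rewrite !mulr_ge0// sumr_ge0. Qed.

Let total_ge0 : 0 <= total_noise.
Proof. by apply: addr_ge0; apply: mulr_ge0 => //; exact: sqr_ge0. Qed.

Context (n : nat) (L gamma : R) (x : nat -> R) (Y u : 'rV[R]_n).
Hypotheses (n_gt0 : (0 < n)%N) (L_ge1 : 1 <= L) (n_large : 32 <= n%:R * lam).
Hypothesis Yx : forall i : 'I_n, Y 0 i = fbar f i + x i.
Hypothesis x_noise : noise_bound x n (b * L).
Hypotheses (gamma_floor : penalty_floor * L < n%:R * gamma).
Hypothesis (gamma_ceiling : gamma < penalty_ceiling).
Hypothesis u_argmin : argmin (potts gamma Y) u.

Let g i := f (design R n i).
Let M := total_noise * L.
Let k := Num.truncn (n%:R * lam / 8).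

Lemma residual_sum_le (s e : nat) : (e <= n)%N ->
  `|\sum_(s <= i < e) (ext0 Y i - g i)| <= `|\sum_(s <= i < e) x i| + bias.
Proof.
move=> en.
have -> : \sum_(s <= i < e) (ext0 Y i - g i) = \sum_(s <= i < e) x i +
    \sum_(s <= i < e) (ext0 (\row_(i < n) fbar f i) i - g i).
  rewrite -big_split/=; apply: eq_big_nat => i /andP[_ ie].
  have ni := leq_trans ie en.
  rewrite -[i in ext0 Y i]/(val (Ordinal ni)) -[i in ext0 (\row_ _ _) i]/(val (Ordinal ni)).
  by rewrite !extE mxE Yx /=; lra.
apply: (le_trans (ler_normD _ _)); rewrite lerD2l.
apply: (le_trans (ler_norm_sum _ _ _)).
exact: fbar_bias.
Qed.

Lemma residual_noise : noise_bound (ext0 Y \- g) n M.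
Proof.
move=> s e sen; have /andP[se en] := sen.
have h := residual_sum_le s en; have hx := x_noise sen.
have l1 : 1 <= (e - s)%:R :> R by rewrite ler1n subn_gt0.
have : `|\sum_(s <= i < e) (ext0 Y i - g i)| ^+ 2 <=
       (`|\sum_(s <= i < e) x i| + bias) ^+ 2.
  by rewrite ler_pXn2r// nnegrE ?addr_ge0.
rewrite real_normK ?num_real//; move/le_trans; apply.
have : `|\sum_(s <= i < e) x i| ^+ 2 <= b * L * (e - s)%:R by rewrite real_normK ?num_real.
move: l1; set l := (e - s)%:R; set z := `|_| => l1 hz.
have Ll : 1 <= L * l.
  by rewrite -[1]mulr1 ler_pM.
apply: (@le_trans _ _ (2 * (b * L * l) + 2 * bias ^+ 2 * (L * l))); last first.
  by rewrite /M /total_noise; lra.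
have h1 : 2 * bias ^+ 2 <= 2 * bias ^+ 2 * (L * l).
  by rewrite ler_peMr// mulr_ge0// sqr_ge0.
by have := sqr_ge0 (z - bias); lra.
Qed.

Let k_itv : k%:R <= n%:R * lam / 8 < k%:R + 1.
Proof.
have h : 0 <= n%:R * lam / 8 :> R by rewrite divr_ge0// mulr_ge0// ltW.
by rewrite natr1; exact: truncn_itv.
Qed.

Let k_gt0 : (0 < k)%N.
Proof. by rewrite -(ltr_nat R); move: k_itv n_large => /andP[_]; lra. Qed.

Let gap : forall j, (j < m)%N -> (breakpoint t n j + 4 * k <= breakpoint t n j.+1)%N.
Proof.
apply: (breakpoint_gap tS t0 t_gap).
by rewrite natrD natrM; move: k_itv n_large => /andP[+ _]; lra.
Qed.

Let gE : forall j i, (j < m)%N ->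
  (breakpoint t n j <= i < breakpoint t n j.+1)%N -> g i = alpha j.
Proof. by move=> j i jm; exact: (@breakpoint_value _ m alpha t tS t0 n j i jm). Qed.

Let u_min : minimizer n (n%:R * gamma) (ext0 Y) (ext0 u).
Proof. exact: argmin_minimizer. Qed.

Let L_ge0 : 0 <= L.
Proof. exact: le_trans L_ge1. Qed.

Let L_neq0 : L != 0.
Proof. by rewrite gt_eqF// (lt_le_trans ltr01). Qed.

Let M_ge0 : 0 <= M.
Proof. exact: mulr_ge0. Qed.

Let J1 : 1 <= J%:R + 1 :> R.
Proof. by rewrite lerDr. Qed.

Let gamma_n_lt : n%:R * gamma * (J%:R + 1) < n%:R * lam * del ^+ 2 / 4096.
Proof.
have J0 : 0 < J%:R + 1 :> R by apply: lt_le_trans J1.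
have : n%:R * gamma < n%:R * penalty_ceiling by rewrite ltr_pM2l ?ltr0n.
rewrite -(ltr_pM2r J0) => /lt_le_trans; apply.
rewrite /penalty_ceiling le_eqVlt; apply/orP; left; apply/eqP.
by field; rewrite gt_eqF.
Qed.

Let G_large : 4 * M * (J%:R + 1) < n%:R * gamma.
Proof. by apply: le_lt_trans gamma_floor; rewrite /M /penalty_floor; lra. Qed.

Let k_del : n%:R * lam * del ^+ 2 / 16 <= k%:R * del ^+ 2.
Proof.
rewrite mulrAC ler_pM2r ?exprn_gt0//.
by move: k_itv n_large => /andP[_]; lra.
Qed.

Let G_small : 2 * (n%:R * gamma) * (J%:R + 1) < k%:R * del ^+ 2 / 2.
Proof.
have h : 0 <= n%:R * lam * del ^+ 2 by rewrite !mulr_ge0 ?sqr_ge0// ltW.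
by move: gamma_n_lt k_del h; rewrite -!mulrA; lra.
Qed.

Let M_small : 4 * M * (2 * J%:R + 1) < n%:R * lam * del ^+ 2 / 2048.
Proof.
have M0 := M_ge0.
have h1 : 4 * M * (2 * J%:R + 1) <= 2 * (4 * M * (J%:R + 1)).
  by have := ler0n R J; have := mulr_ge0 M0 (ler0n R J); lra.
have h2 : n%:R * gamma <= n%:R * gamma * (J%:R + 1).
  rewrite ler_peMr//; apply: ltW; apply: le_lt_trans G_large.
  by rewrite !mulr_ge0// addr_ge0.
by move: G_large gamma_n_lt; lra.
Qed.

Lemma recovered_count : #|jump_set (ext0 u) n| = J.
Proof.
by have [] := minimizer_matching k_gt0 (breakpoint0 t0 n) (breakpoint_last tm n)
  gap gE n_gt0 del_gt0 jump_size u_min residual_noise G_large G_small.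
Qed.

Let f_jumps : jumps f = [set t j | j in [set` jump_set alpha m]].
Proof. exact: jumps_step. Qed.

Lemma recovered_card : (jumps (embed u) #= jumps f)%card.
Proof.
rewrite jumps_embed// f_jumps.
have h1 : ([set design R n i | i in [set` jump_set (ext0 u) n]] #= `I_J)%card.
  rewrite -recovered_count; apply: card_image_finset => i j _ _.
  rewrite /design => /(mulIf _) h; apply: val_inj; apply/eqP.
  by rewrite -(eqr_nat R); apply/eqP; apply: h; rewrite invr_neq0// pnatr_eq0 -lt0n.
have h2 : ([set t j | j in [set` jump_set alpha m]] #= `I_J)%card.
  apply: card_image_finset => i j _ _ tij; apply: val_inj => /=.
  have lt i' j' : (i' < j' < m)%N -> t i' < t j'.
    move=> /andP[ij jm]; apply: lt_le_trans (tS (ltn_trans ij jm)) _.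
    by apply: (grid_le tS); rewrite ij ltnW.
  case: (ltngtP i j) => // ij.
    by have := lt i j; rewrite ij ltn_ord tij ltxx => /(_ isT).
  by have := lt j i; rewrite ij ltn_ord tij ltxx => /(_ isT).
by apply: card_eq_trans h1 _; rewrite card_eq_sym.
Qed.

(** Distances of indices below [w] become distances below [w / n]: rounding [t j]
    up to a design point costs less than one index, and closeness is strict. *)
Lemma rhoH_of_near w :
  (forall j : 'I_m, j \in jump_set alpha m ->
    exists2 i : 'I_n, i \in jump_set (ext0 u) n & close_to w (breakpoint t n j) i) ->
  (forall i : 'I_n, i \in jump_set (ext0 u) n ->
    exists2 j : 'I_m, j \in jump_set alpha m & close_to w (breakpoint t n j) i) ->
  rhoH (jumps (embed u)) (jumps f) <= w%:R / n%:R.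
Proof.
move=> ju uj; have n0R : 0 < n%:R :> R by rewrite ltr0n.
have close (j : 'I_m) (i : 'I_n) : close_to w (breakpoint t n j) i ->
    `|t j - design R n i| <= w%:R / n%:R.
  move=> /andP[h1 h2].
  have /andP[h3 h4] := breakpoint_itv tS t0 n (ltnW (ltn_ord j)).
  have {}h1 : (breakpoint t n j)%:R + 1 <= i%:R + w%:R :> R by rewrite natr1 -natrD ler_nat.
  have {}h2 : i%:R + 1 <= (breakpoint t n j)%:R + w%:R :> R by rewrite natr1 -natrD ler_nat.
  rewrite -(ler_pM2r n0R) divfK ?gt_eqF// -[X in _ * X]gtr0_norm// -normrM.
  rewrite mulrBl /design divfK ?gt_eqF// ler_norml [t j * _]mulrC.
  by apply/andP; split; lra.
rewrite jumps_embed// f_jumps; apply: rhoH_le.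
- by rewrite divr_ge0.
- by move=> _ [i iu <-]; have [j jD ji] := uj _ iu; exists (t j); [exists j|exact: close].
- by move=> _ [j jD <-]; have [i iu ji] := ju _ jD;
    exists (design R n i); [exists i|exact: close].
Qed.

(** The window is the smallest one that the bound on the squared distance
    permits; rounding it up costs the summand 1 of [rate_constant]. *)
Lemma recovered_rate : rhoH (jumps (embed u)) (jumps f) <= rate_constant * (L / n%:R).
Proof.
set q := 8 * M * (2 * J%:R + 1) / del ^+ 2.
have d2 : 0 < del ^+ 2 by rewrite exprn_gt0.
have M0 := M_ge0.
have q0 : 0 <= q.
  apply: divr_ge0; last exact: ltW.
  by apply: mulr_ge0; [exact: mulr_ge0|apply: addr_ge0 => //; exact: mulr_ge0].
have /andP[wq qw] := truncn_itv q0; set w := (Num.truncn q).+1 in qw.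
have qd : q * del ^+ 2 = 8 * M * (2 * J%:R + 1) by rewrite divfK// gt_eqF.
have wk : (w <= k)%N.
  rewrite -(ler_nat R) -natr1.
  have : q <= n%:R * lam / 1024.
    by rewrite -(ler_pM2r d2) qd; move: M_small; lra.
  by move: k_itv n_large => /andP[_]; lra.
have [ju uj] := @jumps_close _ _ _ _ _ _ _ k_gt0 (breakpoint0 t0 n) (breakpoint_last tm n)
  gap gE _ _ _ _ _ n_gt0 del_gt0 jump_size u_min residual_noise G_large G_small w wk
  (ltac:(by move: qw; rewrite -(ltr_pM2r d2) qd -/w; lra)).
apply: (le_trans (rhoH_of_near ju uj)).
rewrite mulrA ler_pM2r ?invr_gt0 ?ltr0n// -natr1 /rate_constant.
have -> : 8 * total_noise * (2 * J%:R + 1) / del ^+ 2 = q / L.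
  by rewrite /q /M; field; rewrite L_neq0 gt_eqF.
by rewrite mulrDl mul1r divfK// lerD.
Qed.

(** For intervals of length at least [K] the averaging error uses up half of the
    allowance [del / 4], which leaves [del / 8] for the noise. *)
Lemma recovered_rate_local K : (0 < K)%N -> 8 * bias <= del * K%:R ->
  (forall j : 'I_m, j \in jump_set alpha m ->
    (forall l, (K <= l)%N -> (l <= breakpoint t n j)%N ->
      `|\sum_(breakpoint t n j - l <= i < breakpoint t n j) x i| <= del / 8 * l%:R) /\
    (forall l, (K <= l)%N -> (breakpoint t n j + l <= n)%N ->
      `|\sum_(breakpoint t n j <= i < breakpoint t n j + l) x i| <= del / 8 * l%:R)) ->
  rhoH (jumps (embed u)) (jumps f) <= K%:R / n%:R.
Proof.
move=> K0 biasK local.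
have biasl l : (K <= l)%N -> bias <= del / 8 * l%:R.
  move=> Kl; have : del * K%:R <= del * l%:R by rewrite ler_pM2l// ler_nat.
  by lra.
have [||ju uj] := @jumps_close_local _ _ _ _ _ _ _ k_gt0 (breakpoint0 t0 n)
  (breakpoint_last tm n) gap gE _ _ _ _ _ n_gt0 del_gt0 jump_size u_min residual_noise
  G_large G_small K K0; last exact: rhoH_of_near ju uj.
- have h : 0 <= n%:R * lam * del ^+ 2 by rewrite !mulr_ge0 ?sqr_ge0// ltW.
  by move: M_small k_del h; rewrite expr_div_n; lra.
- move=> j jD; have [h1 h2] := local _ jD.
  have pn : (breakpoint t n j <= n)%N.
    rewrite (breakpoint_leE tS t0) 1?ltnW//.
    have : t j <= t m by apply: (grid_le tS); rewrite leqnn ltnW.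
    by rewrite tm => /(ler_wpM2l (ler0n R n)); rewrite mulr1.
  split=> l Kl lp; apply: (le_trans (residual_sum_le _ _)) => //.
  + by have := h1 _ Kl lp; have := biasl _ Kl; lra.
  + by have := h2 _ Kl lp; have := biasl _ Kl; lra.
Qed.

End Recovery.

(** * Almost sure and in-probability rates *)

Lemma finite_pos_lower_bound (R : realType) (I : finType) (p : pred I) (F : I -> R) :
  (forall i, p i -> 0 < F i) -> exists2 e, 0 < e & forall i, p i -> e <= F i.
Proof.
move=> F0; exists (\big[Num.min/1]_(i | p i) F i); first exact: lt_bigmin.
by move=> i pi; exact: bigmin_le_cond.
Qed.

Lemma geometric_small (R : realType) (r C e a : R) : 0 <= r < 1 -> 0 <= C -> 0 < e ->
  exists K, [/\ (0 < K)%N, a <= K%:R & C * r ^+ K <= e].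
Proof.
move=> /andP[r0 r1] C0 e0.
have C1 : 0 < C + 1 by lra.
have rn : `|r| < 1 by rewrite ger0_norm.
have h1 : \forall n \near \oo, `|r ^+ n| < e / (C + 1).
  by apply: cvgr0_norm_lt; [exact: cvg_expr|exact: divr_gt0].
have : \forall n \near \oo, [/\ (0 < n)%N, a <= n%:R & C * r ^+ n <= e].
  near=> n; split.
  - by near: n; exact: nbhs_infty_ge.
  - by near: n; exact: nbhs_infty_ger.
  - have : `|r ^+ n| < e / (C + 1) by near: n.
    rewrite ger0_norm ?exprn_ge0// ltr_pdivlMr// => h.
    by have := exprn_ge0 n r0; lra.
by move=> [N _ HN]; exists N; apply: HN => /=.
Unshelve. all: by end_near. Qed.

Theorem theorem3 (R : realType) (d : measure_display) (T : measurableType d)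
  (P : probability T R) (f : R -> R)
  (xi : forall n : nat, 'I_n -> {RV P >-> R})
  (gamma : nat -> {RV P >-> R}) (fhat : nat -> T -> R -> R)
  (f_step : S01 f) (xiA : conditionA xi)
  (gamma_cvg0 : {ae P, forall w, gamma n w @[n --> \oo] --> (0 : R)})
  (gamma_log : {ae P, forall w,
     gamma n w * n%:R / ln (n%:R : R) @[n --> \oo] --> +oo})
  (fhat_argmin : forall (n : nat) (w : T), (0 < n)%N ->
     (@embed R n @` argmin (potts (gamma n w) (observation f xi n w)))
       (fhat n w)) :
  [/\ {ae P, forall w, \forall n \near \oo,
         (jumps (fhat n w) #= jumps f)%card},
      {ae P, forall w,
         (fun n => rhoH (jumps (fhat n w)) (jumps f)) =O_\oo
         (fun n => ln (n%:R : R) / n%:R)} &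
      bigO_prob P (fun n w => rhoH (jumps (fhat n w)) (jumps f))
        (fun n => n%:R^-1)].
Proof.
case: f_step => m [alpha [t [t0 tm tS fE]]].
have {fE} fE : f = step_fun m alpha t by [].
case: xiA => _ xi_ind [beta0 xi_mgf0].
(* A positive constant is needed as a denominator. *)
pose beta := Num.max beta0 1.
have beta_gt0 : 0 < beta by rewrite lt_max ltr01 orbT.
have xi_mgf n (i : 'I_n) nu : ('M_P (xi n i) nu <= (expR (beta * nu ^+ 2))%:E)%E.
  apply: (le_trans (xi_mgf0 n i nu)); rewrite lee_fin ler_expR ler_wpM2r ?sqr_ge0//.
  by rewrite le_max lexx.
have [lam lam_gt0 t_gap'] : exists2 lam, 0 < lam &
    forall j : 'I_m, true -> lam <= t j.+1 - t j.
  by apply: finite_pos_lower_bound => j _; rewrite subr_gt0 tS.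
have t_gap j : (j < m)%N -> lam <= t j.+1 - t j by move=> jm; exact: (t_gap' (Ordinal jm)).
have [del del_gt0 jump_size] : exists2 del, 0 < del &
    forall j : 'I_m, j \in jump_set alpha m -> del <= `|alpha j.-1 - alpha j|.
  apply: finite_pos_lower_bound => j; rewrite inE => /andP[_ h].
  by rewrite normr_gt0 subr_eq0.
pose b := 16 * beta.
have b_ge0 : 0 <= b by rewrite mulr_ge0// ltW.
pose floor := penalty_floor m alpha b.
pose ceiling := penalty_ceiling m alpha lam del.
have ceiling_gt0 : 0 < ceiling.
  apply: divr_gt0; first by rewrite mulr_gt0 ?exprn_gt0.
  by apply: mulr_gt0; [rewrite ltr0n|rewrite natr1 ltr0n].
have [N0 N0P] : exists N0, forall n, (N0 <= n)%N ->
    [/\ (0 < n)%N, 1 <= ln n%:R :> R & 32 <= n%:R * lam].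
  have : \forall n \near \oo, expR 1 <= n%:R :> R by exact: nbhs_infty_ger.
  have : \forall n \near \oo, 32 / lam <= n%:R by exact: nbhs_infty_ger.
  move=> [N1 _ H1] [N2 _ H2]; exists (maxn N1 N2) => n; rewrite geq_max => /andP[h1 h2].
  have /= e2 := H2 _ h2; have /= e1 := H1 _ h1.
  have n0 : 0 < n%:R :> R by apply: lt_le_trans e2; exact: expR_gt0.
  split; first by rewrite -(ltr0n R).
  - by rewrite -[leLHS]expRK ler_ln ?posrE// expR_gt0.
  - by move: e1; rewrite ler_pdivrMr.
(* The samples at which the noise or the penalty violates a hypothesis of the
   deterministic recovery lemmas. *)
pose bad n : set T := loud xi beta n `|`
  ([set w | n%:R * gamma n w <= floor * ln n%:R] `|` [set w | ceiling <= gamma n w]).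
have mbad n : measurable (bad n).
  apply: measurableU; first exact: measurable_loud.
  apply: measurableU.
    rewrite -[X in measurable X]setTI; apply: measurable_fun_le => //.
    by apply: measurable_funM => //; exact: measurable_funPT.
  rewrite -[X in measurable X]setTI; apply: measurable_fun_le => //.
have nbad : {ae P, forall w, \forall n \near \oo, ~ bad n w}.
  have := eventually_not_loud xi_ind beta_gt0 xi_mgf.
  move: gamma_cvg0 gamma_log; apply: filterS3 => w cvg0 /cvgryPgt/(_ floor) gl nl.
  have gc : \forall n \near \oo, gamma n w < ceiling.
    exact: (cvgr_lt _ cvg0 ceiling ceiling_gt0).
  near=> n => -[|[|]] /=.
  - by near: n.
  - apply/negP; rewrite -ltNge.
    have ln1 : 1 <= ln n%:R :> R.
      by have [] := N0P n; first by near: n; exact: nbhs_infty_ge.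
    have : floor < gamma n w * n%:R / ln n%:R by near: n.
    by rewrite ltr_pdivlMr ?(lt_le_trans ltr01)// [gamma n w * _]mulrC.
  - by apply/negP; rewrite -ltNge; near: n.
have good_hyps n w : (N0 <= n)%N -> ~ bad n w -> exists2 u : 'rV[R]_n,
    fhat n w = embed u /\ argmin (potts (gamma n w) (observation f xi n w)) u &
    [/\ noise_bound (ext0 (\row_(j < n) xi n j w)) n (b * ln n%:R),
        floor * ln n%:R < n%:R * gamma n w & gamma n w < ceiling].
  move=> /N0P[n0 _ _] gn; have [u u_min <-] := fhat_argmin n w n0.
  exists u => //; split.
  - by apply: not_loud => // h; apply: gn; left.
  - by rewrite ltNge; apply/negP => h; apply: gn; right; left.
  - by rewrite ltNge; apply/negP => h; apply: gn; right; right.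
have obsE n w (i : 'I_n) : observation f xi n w 0 i =
    fbar (step_fun m alpha t) i + ext0 (\row_(j < n) xi n j w) i.
  by rewrite -fE mxE extE mxE.
have card_good n w : (N0 <= n)%N -> ~ bad n w -> (jumps (fhat n w) #= jumps f)%card.
  move=> Nn gn; have [u [-> u_min] [h1 h2 h3]] := good_hyps _ _ Nn gn.
  have [n0 L1 nlam] := N0P _ Nn; rewrite fE.
  exact: (recovered_card tS t0 tm lam_gt0 del_gt0 t_gap jump_size n0 L1 nlam
    (obsE n w) h1 h2 h3 u_min).
have rate_good n w : (N0 <= n)%N -> ~ bad n w ->
    rhoH (jumps (fhat n w)) (jumps f) <= rate_constant m alpha del b * (ln n%:R / n%:R).
  move=> Nn gn; have [u [-> u_min] [h1 h2 h3]] := good_hyps _ _ Nn gn.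
  have [n0 L1 nlam] := N0P _ Nn; rewrite fE.
  exact: (recovered_rate tS t0 tm lam_gt0 del_gt0 b_ge0 t_gap jump_size n0 L1 nlam
    (obsE n w) h1 h2 h3 u_min).
have rho01 n w : 0 <= rhoH (jumps (fhat n w)) (jumps f) <= 1.
  by apply: rhoH_unit => x [x01 _]; rewrite /= in_itv.
split.
- move: nbad; apply: filterS => w gw; near=> n.
  apply: card_good; first by near: n; exact: nbhs_infty_ge.
  by near: n.
- move: nbad; apply: filterS => w gw.
  apply/eqOP; near=> k; near=> n.
  have Nn : (N0 <= n)%N by near: n; exact: nbhs_infty_ge.
  have [n0 L1 _] := N0P _ Nn.
  have Ln0 : 0 <= ln n%:R / n%:R :> R by rewrite divr_ge0// (le_trans ler01).
  have /andP[rho0 _] := rho01 n w.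
  rewrite !ger0_norm//; apply: (le_trans (rate_good _ _ Nn _)); first by near: n.
  by rewrite ler_wpM2r//; near: k; exact: nbhs_pinfty_ge.
- move=> eps eps0; have eps2 : 0 < eps / 2 by rewrite divr_gt0.
  have [N1 N1P] := eventually_never_small mbad eps2 nbad.
  pose eta := del / 8.
  have eta_gt0 : 0 < eta by rewrite divr_gt0.
  pose r := drift_rate beta eta.
  have r01 : 0 <= r < 1.
    rewrite expR_ge0 /r /drift_rate expR_lt1 oppr_lt0 divr_gt0 ?exprn_gt0//.
    by rewrite mulr_gt0.
  pose C := 4 * m%:R / (1 - r).
  have C0 : 0 <= C by rewrite divr_ge0 ?mulr_ge0// subr_ge0 ltW//; case/andP: r01.
  pose bias := 2 * step_bound m alpha * m%:R.
  have [K [K0 Kbias Keps]] := geometric_small (8 * bias / del) r01 C0 eps2.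
  pose left n (j : nat) := drift xi eta n (fun l => breakpoint t n j - l)%N K.
  pose right n (j : nat) := drift xi eta n (fun=> breakpoint t n j) K.
  pose drifts n := \big[setU/set0]_(j < m) (left n j `|` right n j).
  have mleft n j : measurable (left n j) by exact: measurable_drift.
  have mright n j : measurable (right n j) by exact: measurable_drift.
  have mdrifts n : measurable (drifts n).
    by apply: bigsetU_measurable => j _; exact: measurableU.
  have Pdrifts n : (P (drifts n) <= (eps / 2)%:E)%E.
    apply: (@le_trans _ _ (\sum_(j < m) (2 * (r ^+ K / (1 - r)) + 2 * (r ^+ K / (1 - r))))%:E).
      apply: (@measure_bigsetU_le _ _ _ _ _ (fun j => left n j `|` right n j)
        (fun=> 2 * (r ^+ K / (1 - r)) + 2 * (r ^+ K / (1 - r)))) => j _.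
        exact: measurableU.
      apply: (le_trans (measureU2 P (mleft n j) (mright n j))).
      by rewrite EFinD leeD// drift_prob.
    rewrite lee_fin sumr_const card_ord -[_ *+ m]mulr_natl; apply: le_trans Keps.
    by rewrite /C le_eqVlt; apply/orP; left; apply/eqP; ring.
  (* Below max N1 N0 the constant exceeds n, so that the bound follows from the
     distance being at most 1. *)
  exists (maxn K (maxn N1 N0))%:R => n n0.
  have n0R : 0 < n%:R :> R by rewrite ltr0n.
  have [small|] := ltnP n (maxn N1 N0).
    rewrite (_ : [set w | _] = set0); first by rewrite mu_ext0// ltW.
    apply/seteqP; split => // w /=; apply/negP; rewrite -leNgt.
    have /andP[rho0 rho1] := rho01 n w.
    rewrite !ger0_norm ?invr_ge0//; apply: (le_trans rho1).
    rewrite ler_pdivlMr// mul1r ler_nat ltnW//.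
    by apply: leq_trans small _; exact: leq_maxr.
  rewrite geq_max => /andP[N1n N0n].
  apply: (@le_trans _ _ (mu_ext P (bad n `|` drifts n))).
    apply: le_mu_ext => w /= large.
    apply: contrapT => /not_orP[gn nd]; move: large; apply/negP; rewrite -leNgt.
    have /andP[rho0 rho1] := rho01 n w.
    rewrite !ger0_norm ?invr_ge0//.
    have [u [-> u_min] [h1 h2 h3]] := good_hyps _ _ N0n gn.
    have [_ L1 nlam] := N0P _ N0n.
    have loc (j : 'I_m) : j \in jump_set alpha m ->
      (forall l, (K <= l)%N -> (l <= breakpoint t n j)%N ->
        `|\sum_(breakpoint t n j - l <= i < breakpoint t n j)
            ext0 (\row_(j < n) xi n j w) i| <= eta * l%:R) /\
      (forall l, (K <= l)%N -> (breakpoint t n j + l <= n)%N ->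
        `|\sum_(breakpoint t n j <= i < breakpoint t n j + l)
            ext0 (\row_(j < n) xi n j w) i| <= eta * l%:R).
      move=> jD; have [nl nr] : ~ left n j w /\ ~ right n j w.
        apply/not_orP => h; apply: nd.
        exact: (@mem_bigsetU _ _ _ (fun j => left n j `|` right n j) j).
      have pn : (breakpoint t n j <= n)%N.
        rewrite (breakpoint_leE tS t0) 1?ltnW//.
        have : t j <= t m by apply: (grid_le tS); rewrite leqnn ltnW.
        by rewrite tm => /(ler_wpM2l (ler0n R n)); rewrite mulr1.
      split=> l Kl lp.
        by have := not_drift nl Kl; rewrite subnK//; exact.
      exact: (not_drift nr Kl lp).
    rewrite fE; apply: le_trans
      (recovered_rate_local tS t0 tm lam_gt0 del_gt0 b_ge0 t_gap jump_size n0 L1 nlam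
        (obsE n w) h1 h2 h3 u_min K0 _ loc) _.
      by move: Kbias; rewrite ler_pdivrMr// [K%:R * del]mulrC.
    by rewrite ler_pM2r ?invr_gt0// ler_nat leq_maxl.
  rewrite measurable_mu_extE; last exact: measurableU.
  apply: (le_trans (measureU2 P (mbad n) (mdrifts n))).
  by rewrite [eps in leRHS]splitr EFinD; apply: leeD; [exact: N1P|exact: Pdrifts].
Unshelve. all: by end_near. Qed.
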